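(* Let $(V,m,\sigma)$ be a Yang-Baxter algebra. For any object $(H,\cdot,\bigtriangleup_H,\alpha)$ of $CB_{\mathcal{YB}}$ and any linear map $f\colon H\to V$ such that $m\circ(f\otimes f)=f\circ\cdot$ on $\overline{H}\otimes\overline{H}$, $f(1_H)=0$ and $(f\otimes f)\alpha=\sigma(f\otimes f)$, there exists a unique morphism $\overline{f}\colon H\to(T^c(V),\Join_\sigma,\delta,\beta)$ in $CB_{\mathcal{YB}}$ which extends $f$, i.e. $Pr_V\circ\overline{f}=f$, where $Pr_V\colon T^c(V)\to V$ is the projection onto $V$.
   Context: $K$ is a ground field of characteristic $0$; all objects are over $K$; algebras are associative and unital. A braiding on a vector space $V$ is an invertible $\sigma\in\mathrm{End}(V\otimes V)$ with $(\sigma\otimes \mathrm{id}_V)(\mathrm{id}_V\otimes\sigma)(\sigma\otimes \mathrm{id}_V)=(\mathrm{id}_V\otimes\sigma)(\sigma\otimes \mathrm{id}_V)(\mathrm{id}_V\otimes\sigma)$ on $V^{\otimes 3}$. On $V^{\otimes n}$ put $\sigma_i=\mathrm{id}_V^{\otimes(i-1)}\otimes\sigma\otimes\mathrm{id}_V^{\otimes(n-i-1)}$. Operators compose from right to left. For $w\in\mathfrak S_n$ with reduced expression $w=s_{i_1}\cdots s_{i_l}$, $s_i=(i,i+1)$, put $T^\sigma_w=\sigma_{i_1}\cdots\sigma_{i_l}$ (well defined). Yang-Baxter (YB) algebra: $(A,m,\sigma)$ with $(A,m)$ an algebra with unit $1_A$ and $\sigma$ a braiding on $A$ such that $(\mathrm{id}_A\otimes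 m)\sigma_1\sigma_2=\sigma(m\otimes\mathrm{id}_A)$, $(m\otimes\mathrm{id}_A)\sigma_2\sigma_1=\sigma(\mathrm{id}_A\otimes m)$, and $\sigma(1_A\otimes a)=a\otimes 1_A$, $\sigma(a\otimes 1_A)=1_A\otimes a$ for all $a\in A$. YB coalgebra: $(C,\bigtriangleup,\sigma)$ with $(C,\bigtriangleup,\varepsilon)$ a coalgebra and $\sigma$ a braiding on $C$ such that $\sigma_1\sigma_2(\bigtriangleup\otimes\mathrm{id}_C)=(\mathrm{id}_C\otimes\bigtriangleup)\sigma$, $\sigma_2\sigma_1(\mathrm{id}_C\otimes\bigtriangleup)=(\bigtriangleup\otimes\mathrm{id}_C)\sigma$, $(\mathrm{id}_C\otimes\varepsilon)\sigma=\varepsilon\otimes\mathrm{id}_C$ and $(\varepsilon\otimes\mathrm{id}_C)\sigma=\mathrm{id}_C\otimes\varepsilon$. The twisted coalgebra structure on $C\otimes C$ has coproduct $(\mathrm{id}_C\otimes\sigma\otimes\mathrm{id}_C)(\bigtriangleup\otimes\bigtriangleup)$ and counit $\varepsilon\otimes\varepsilon$. For a YB algebra $A$, the twisted algebra structure on $A\otimes A$ has product $(m\otimes m)(\mathrm{id}_A\otimes\sigma\otimes\mathrm{id}_A)$ and unit $1_A\otimes 1_A$. Connectedness: let $(C,\bigtriangleup,\varepsilon)$ be a coalgebra with a preferred group-like element $1_C$, and put $\overline{\bigtriangleup}(x)=\bigtriangleup(x)-x\otimes1_C-1_C\otimes x$ and $\overline{C}=\mathrm{Ker}\,\varepsilon$.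 $C$ is connected if $C=\bigcup_{r\ge0}F_rC$, where $F_0C=K1_C$ and $F_rC=\{x\in C\mid\overline{\bigtriangleup}(x)\in F_{r-1}C\otimes F_{r-1}C\}$ for $r\ge1$. Twisted YB bialgebra: $(H,\cdot,\bigtriangleup,\sigma)$ such that $(H,\cdot,\sigma)$ is a YB algebra, $(H,\bigtriangleup,\sigma)$ is a YB coalgebra, and $\cdot\colon H\otimes H\to H$ is a coalgebra map for the twisted coalgebra structure on $H\otimes H$ (or equivalently $\bigtriangleup\colon H\to H\otimes H$ is an algebra map for the twisted algebra structure); in particular $\bigtriangleup(1_H)=1_H\otimes1_H$. The category $CB_{\mathcal{YB}}$ of connected twisted YB bialgebras: objects are the twisted YB bialgebras $(H,\cdot,\bigtriangleup,\sigma)$ such that both $H$ and $H\otimes H$ (with the twisted coalgebra structure) are connected with respect to the group-like elements $1_H$ and $1_H\otimes1_H$; a morphism from $(H_1,\sigma_1)$ to $(H_2,\sigma_2)$ is a map $g$ that is both an algebra map and a coalgebra map and satisfies $(g\otimes g)\sigma_1=\sigma_2(g\otimes g)$. The object $(T^c(V),\Join_\sigma,\delta,\beta)$ of $CB_{\mathcal{YB}}$: $T(V)=\bigoplus_{n\ge0}V^{\otimes n}$, $V^{\otimes0}=K$; $\underline{\otimes}$ denotes the tensor product between copies of $T(V)$. For $i,j\ge1$ let $\chi_{ij}\in\mathfrak S_{i+j}$, $\chi_{ij}(k)=j+k$ for $1\le k\le i$ and $\chi_{ij}(i+k)=k$ for $1\le k\le j$. The braiding $\beta$ on $T(V)$ is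 $\beta_{ij}=T^\sigma_{\chi_{ij}}$ on $V^{\otimes i}\underline{\otimes}V^{\otimes j}$ ($i,j\ge1$), with $\beta_{0i},\beta_{i0}$ the usual flips. $T^c(V)=(T(V),\delta,\varepsilon)$, where $\delta(v_1\otimes\cdots\otimes v_n)=\sum_{i=0}^n(v_1\otimes\cdots\otimes v_i)\underline{\otimes}(v_{i+1}\otimes\cdots\otimes v_n)$ and $\varepsilon$ is the projection $T(V)\to K$. Define $M_{pq}\colon V^{\otimes p}\underline{\otimes}V^{\otimes q}\to V$ by $M_{00}=0$, $M_{10}=\mathrm{id}_V=M_{01}$, $M_{11}=m$, $M_{pq}=0$ otherwise, and $M=(M_{pq})\colon T^c(V)\underline{\otimes}T^c(V)\to V$. Put $\bigtriangleup_\beta=(\mathrm{id}\otimes\beta\otimes\mathrm{id})(\delta\otimes\delta)$, $\bigtriangleup_\beta^{(0)}=\mathrm{id}$, $\bigtriangleup_\beta^{(n)}=(\bigtriangleup_\beta\otimes\mathrm{id}_{T^c(V)}^{\otimes 2(n-1)})\circ\bigtriangleup_\beta^{(n-1)}$. The quantum quasi-shuffle product is $\Join_\sigma=\varepsilon\otimes\varepsilon+\sum_{n\ge1}M^{\otimes n}\circ\bigtriangleup_\beta^{(n-1)}\colon T^c(V)\underline{\otimes}T^c(V)\to T^c(V)$ (finite sum on each element); its unit is $1\in K$. *)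

(* Defs.v *)
From HB Require Import structures.
From mathcomp Require Import all_boot all_order all_fingroup all_algebra.
From mathcomp Require Import generic_quotient sesquilinear.
From mathcomp Require Import boolp zify.

Set Implicit Arguments.
Unset Strict Implicit.
Unset Printing Implicit Defensive.

Import GRing.Theory.
Local Open Scope ring_scope.
Local Open Scope quotient_scope.

Section Tensor.
Variables (K : fieldType) (U V : lmodType K).

Definition tens_eval (W : lmodType K) (b : U -> V -> W) (s : seq (U * V)) : W :=
  \sum_(p <- s) b p.1 p.2.

(* The tensor product is the type of formal sums [:: (u1, v1); ...; (un, vn)]
   of pure tensors, two of them being identified when every bilinear map takes
   the same value on both. Its universal property is tens_liftE (existence)
   and tens_ext (uniqueness). *)
Definition tens_rel (s t : seq (U * V)) : bool :=
  `[< forall (W : lmodType K) (b : {bilinear U -> V -> W}),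
        tens_eval b s = tens_eval b t >].

Lemma tens_rel_equiv : equiv_class_of tens_rel.
Proof.
split=> [s|s t|t s u]; first by apply/asboolP.
  by apply/asboolP/asboolP => h W b; rewrite h.
by move=> /asboolP h1 /asboolP h2; apply/asboolP => W b; rewrite h1 h2.
Qed.

Canonical tens_equiv := EquivRelPack tens_rel_equiv.

Definition tens := {eq_quot tens_equiv}.
HB.instance Definition _ := Choice.on tens.
HB.instance Definition _ := EqQuotient.on tens.

Lemma tens_eqP (s t : seq (U * V)) :
  (forall (W : lmodType K) (b : {bilinear U -> V -> W}),
     tens_eval b s = tens_eval b t) <-> \pi_tens s = \pi_tens t.
Proof.
split=> [h|/eqmodP /asboolP //]; apply/eqmodP; exact/asboolP.
Qed.

Lemma tens_eval_repr (W : lmodType K) (b : {bilinear U -> V -> W}) s :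
  tens_eval b (repr (\pi_tens s)) = tens_eval b s.
Proof. by move: W b; apply/tens_eqP; rewrite reprK. Qed.

Lemma tens_eval_cat (W : lmodType K) (b : U -> V -> W) s t :
  tens_eval b (s ++ t) = tens_eval b s + tens_eval b t.
Proof. exact: big_cat. Qed.

Definition tens_scale_seq (a : K) (s : seq (U * V)) : seq (U * V) :=
  [seq (a *: p.1, p.2) | p <- s].

Lemma tens_eval_scale (W : lmodType K) (b : {bilinear U -> V -> W}) a s :
  tens_eval b (tens_scale_seq a s) = a *: tens_eval b s.
Proof.
rewrite /tens_eval big_map scaler_sumr; apply: eq_bigr => p _ /=.
exact: linearZl_LR.
Qed.

Definition tens0 : tens := \pi_tens [::].
Definition tens_add (x y : tens) : tens := \pi_tens (repr x ++ repr y).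
Definition tens_scale (a : K) (x : tens) : tens :=
  \pi_tens (tens_scale_seq a (repr x)).
Definition tens_opp (x : tens) : tens := tens_scale (-1) x.

Definition tens_lift_fun (W : lmodType K) (b : U -> V -> W) (x : tens) : W :=
  tens_eval b (repr x).

Lemma tens_lift_sep (x y : tens) :
  (forall (W : lmodType K) (b : {bilinear U -> V -> W}),
     tens_lift_fun b x = tens_lift_fun b y) -> x = y.
Proof. by move=> h; rewrite -[x]reprK -[y]reprK; apply/tens_eqP. Qed.

Section Lift.
Variables (W : lmodType K) (b : {bilinear U -> V -> W}).
Let L := tens_lift_fun b.

Lemma tens_lift_fun0 : L tens0 = 0.
Proof. by rewrite /L /tens_lift_fun tens_eval_repr /tens_eval big_nil. Qed.
Lemma tens_lift_funD x y : L (tens_add x y) = L x + L y.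
Proof. by rewrite /L /tens_lift_fun tens_eval_repr tens_eval_cat. Qed.
Lemma tens_lift_funZ a x : L (tens_scale a x) = a *: L x.
Proof. by rewrite /L /tens_lift_fun tens_eval_repr tens_eval_scale. Qed.
End Lift.

Let tE := (tens_lift_fun0, tens_lift_funD, tens_lift_funZ).

Fact tens_addA : associative tens_add.
Proof. by move=> x y z; apply: tens_lift_sep => W b; rewrite !tE addrA. Qed.
Fact tens_addC : commutative tens_add.
Proof. by move=> x y; apply: tens_lift_sep => W b; rewrite !tE addrC. Qed.
Fact tens_add0 : left_id tens0 tens_add.
Proof. by move=> x; apply: tens_lift_sep => W b; rewrite !tE add0r. Qed.
Fact tens_addN : left_inverse tens0 tens_opp tens_add.
Proof.
by move=> x; apply: tens_lift_sep => W b; rewrite !tE scaleN1r addNr.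
Qed.
HB.instance Definition _ :=
  GRing.isZmodule.Build tens tens_addA tens_addC tens_add0 tens_addN.

Fact tens_scaleA a b (x : tens) :
  tens_scale a (tens_scale b x) = tens_scale (a * b) x.
Proof. by apply: tens_lift_sep => W f; rewrite !tE scalerA. Qed.
Fact tens_scale1 : left_id 1 tens_scale.
Proof. by move=> x; apply: tens_lift_sep => W b; rewrite !tE scale1r. Qed.
Fact tens_scaleDr : right_distributive tens_scale +%R.
Proof. by move=> a x y; apply: tens_lift_sep => W b; rewrite !tE scalerDr. Qed.
Fact tens_scaleDl x : {morph tens_scale^~ x : a b / a + b}.
Proof. by move=> a b; apply: tens_lift_sep => W f; rewrite !tE scalerDl. Qed.
HB.instance Definition _ := GRing.Zmodule_isLmodule.Build K tens
  tens_scaleA tens_scale1 tens_scaleDr tens_scaleDl.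

Definition tpure (u : U) (v : V) : tens := \pi_tens [:: (u, v)].

Lemma tens_lift_fun_pure (W : lmodType K) (b : {bilinear U -> V -> W}) u v :
  tens_lift_fun b (tpure u v) = b u v.
Proof. by rewrite /tens_lift_fun tens_eval_repr /tens_eval big_seq1. Qed.

Fact tpure_is_bilinear : bilinear_for *:%R *:%R tpure.
Proof.
split=> [v a u u'|u a v v']; apply: tens_lift_sep => W b;
  rewrite tens_lift_funD tens_lift_funZ !tens_lift_fun_pure.
  exact: linearPl.
exact: linearPr.
Qed.
HB.instance Definition _ :=
  bilinear_isBilinear.Build K U V tens *:%R *:%R tpure tpure_is_bilinear.

Definition tens_lift (W : lmodType K) (b : {bilinear U -> V -> W}) : tens -> W :=
  tens_lift_fun b.

Fact tens_lift_is_linear (W : lmodType K) (b : {bilinear U -> V -> W}) :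
  linear (tens_lift b).
Proof. by move=> a x y; rewrite /tens_lift tens_lift_funD tens_lift_funZ. Qed.
HB.instance Definition _ (W : lmodType K) (b : {bilinear U -> V -> W}) :=
  GRing.isLinear.Build K tens W *:%R (tens_lift b) (tens_lift_is_linear b).

Lemma tens_liftE (W : lmodType K) (b : {bilinear U -> V -> W}) u v :
  tens_lift b (tpure u v) = b u v.
Proof. exact: tens_lift_fun_pure. Qed.

Lemma tens_sum (x : tens) :
  exists s : seq (U * V), x = \sum_(p <- s) tpure p.1 p.2.
Proof.
exists (repr x); apply: tens_lift_sep => W b.
have -> : tens_lift_fun b (\sum_(p <- repr x) tpure p.1 p.2)
    = \sum_(p <- repr x) tens_lift b (tpure p.1 p.2).
  exact: (linear_sum (tens_lift b)).
by apply: eq_bigr => p _; rewrite tens_liftE.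
Qed.

Lemma tens_ext (W : lmodType K) (f g : {linear tens -> W}) :
  (forall u v, f (tpure u v) = g (tpure u v)) -> f =1 g.
Proof.
by move=> h x; have [s ->] := tens_sum x; rewrite !linear_sum; apply: eq_bigr.
Qed.

End Tensor.

Notation "U ⊗ V" := (tens U V) (at level 40, left associativity) : type_scope.
Notation "u \tens v" := (tpure u v) (at level 40, left associativity) : ring_scope.

(* The span of the pure tensors [u \tens v] with [P u v]; for [P u v] of the
   form [A u /\ B v] with subspaces A and B this is the image of A ⊗ B. *)
Inductive tspan (K : fieldType) (U V : lmodType K) (P : U -> V -> Prop) :
    tens U V -> Prop :=
| tspan0 : tspan P 0
| tspanD a u v x : P u v -> tspan P x -> tspan P (a *: (u \tens v) + x).

Section TensorMaps.
Variable K : fieldType.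
Implicit Types U V W X : lmodType K.

Definition tmap_fun U V U' V' (f : {linear U -> U'}) (g : {linear V -> V'})
  (u : U) (v : V) : U' ⊗ V' := f u \tens g v.

Fact tmap_is_bilinear U V U' V' (f : {linear U -> U'}) (g : {linear V -> V'}) :
  bilinear_for *:%R *:%R (tmap_fun f g).
Proof.
split=> [v a u u'|u a v v']; rewrite /tmap_fun.
  by rewrite (linearP f) linearPl.
by rewrite (linearP g) linearPr.
Qed.
HB.instance Definition _ U V U' V' (f : {linear U -> U'}) (g : {linear V -> V'})
  := bilinear_isBilinear.Build K U V (U' ⊗ V') *:%R *:%R (tmap_fun f g)
       (tmap_is_bilinear f g).

Definition tmap U V U' V' (f : {linear U -> U'}) (g : {linear V -> V'}) :
  {linear U ⊗ V -> U' ⊗ V'} := tens_lift (tmap_fun f g).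

Fact tpure_r_is_linear U V (v : V) : linear (fun u : U => u \tens v).
Proof. by move=> a x y; rewrite linearPl. Qed.
Definition tpure_r U V (v : V) (u : U) : U ⊗ V := u \tens v.
HB.instance Definition _ U V (v : V) :=
  GRing.isLinear.Build K U (U ⊗ V) *:%R (@tpure_r U V v) (tpure_r_is_linear v).

Fact tpure_l_is_linear U V (u : U) : linear (fun v : V => u \tens v).
Proof. by move=> a x y; rewrite linearPr. Qed.
Definition tpure_l U V (u : U) (v : V) : U ⊗ V := u \tens v.
HB.instance Definition _ U V (u : U) :=
  GRing.isLinear.Build K V (U ⊗ V) *:%R (@tpure_l U V u) (tpure_l_is_linear u).

Definition tassocr_fun U V W (x : U ⊗ V) (w : W) : U ⊗ (V ⊗ W) :=
  tmap idfun (tpure_r w) x.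

Lemma tmap_pure U V U' V' (f : {linear U -> U'}) (g : {linear V -> V'}) u v :
  tmap f g (u \tens v) = f u \tens g v.
Proof. exact: tens_liftE. Qed.

Fact tassocr_is_bilinear U V W :
  bilinear_for *:%R *:%R (@tassocr_fun U V W).
Proof.
split=> [w a x y|x a w w']; first by rewrite /tassocr_fun linearP.
have [s ->] := tens_sum x; rewrite /tassocr_fun !linear_sum /= scaler_sumr -big_split.
by apply: eq_bigr => -[u v] _ /=; rewrite !tmap_pure /= /tpure_r !linearPr.
Qed.
HB.instance Definition _ U V W := bilinear_isBilinear.Build K (U ⊗ V) W
  (U ⊗ (V ⊗ W)) *:%R *:%R (@tassocr_fun U V W) (@tassocr_is_bilinear U V W).

Definition tassocr U V W : {linear (U ⊗ V) ⊗ W -> U ⊗ (V ⊗ W)} :=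
  tens_lift (@tassocr_fun U V W).

Lemma tassocr_pure U V W (u : U) (v : V) (w : W) :
  tassocr U V W (u \tens v \tens w) = u \tens (v \tens w).
Proof. by rewrite /tassocr /= tens_liftE /= /tassocr_fun tmap_pure. Qed.

Definition tassocl_fun U V W (u : U) (x : V ⊗ W) : (U ⊗ V) ⊗ W :=
  tmap (tpure_l u) idfun x.

Fact tassocl_is_bilinear U V W :
  bilinear_for *:%R *:%R (@tassocl_fun U V W).
Proof.
split=> [x a u u'|u a x y]; last by rewrite /tassocl_fun linearP.
have [s ->] := tens_sum x; rewrite /tassocl_fun !linear_sum /= scaler_sumr -big_split.
by apply: eq_bigr => -[v w] _ /=; rewrite !tmap_pure /= /tpure_l !linearPl.
Qed.
HB.instance Definition _ U V W := bilinear_isBilinear.Build K U (V ⊗ W)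
  ((U ⊗ V) ⊗ W) *:%R *:%R (@tassocl_fun U V W) (@tassocl_is_bilinear U V W).

Definition tassocl U V W : {linear U ⊗ (V ⊗ W) -> (U ⊗ V) ⊗ W} :=
  tens_lift (@tassocl_fun U V W).

Lemma tassocl_pure U V W (u : U) (v : V) (w : W) :
  tassocl U V W (u \tens (v \tens w)) = u \tens v \tens w.
Proof. by rewrite /tassocl /= tens_liftE /= /tassocl_fun tmap_pure. Qed.

Definition tflip_fun U V (u : U) (v : V) : V ⊗ U := v \tens u.
Fact tflip_is_bilinear U V : bilinear_for *:%R *:%R (@tflip_fun U V).
Proof.
by split=> [v a u u'|u a v v']; rewrite /tflip_fun ?linearPl ?linearPr.
Qed.
HB.instance Definition _ U V := bilinear_isBilinear.Build K U V
  (V ⊗ U) *:%R *:%R (@tflip_fun U V) (@tflip_is_bilinear U V).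
Definition tflip U V : {linear U ⊗ V -> V ⊗ U} := tens_lift (@tflip_fun U V).

Definition tlunit_fun U (c : K^o) (u : U) : U := (c : K) *: u.
Fact tlunit_is_bilinear U : bilinear_for *:%R *:%R (@tlunit_fun U).
Proof.
split=> [v a u u'|u a v v']; rewrite /tlunit_fun.
  by rewrite scalerDl /= scalerA.
by rewrite /= scalerDr !scalerA mulrC.
Qed.
HB.instance Definition _ U := bilinear_isBilinear.Build K K^o U
  U *:%R *:%R (@tlunit_fun U) (@tlunit_is_bilinear U).
Definition tlunit U : {linear K^o ⊗ U -> U} := tens_lift (@tlunit_fun U).
Definition trunit U : {linear U ⊗ K^o -> U} := tlunit U \o tflip U K^o.

Lemma tflip_pure U V (u : U) (v : V) : tflip U V (u \tens v) = v \tens u.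
Proof. exact: tens_liftE. Qed.
Lemma tlunit_pure U (c : K^o) (u : U) : tlunit U (c \tens u) = (c : K) *: u.
Proof. exact: tens_liftE. Qed.
Lemma trunit_pure U (c : K^o) (u : U) : trunit U (u \tens c) = (c : K) *: u.
Proof. by rewrite /trunit /= tflip_pure tlunit_pure. Qed.

(* g ⊗ id_X, on right-nested tensor products. *)
Definition act12 U V U' V' (g : {linear U ⊗ V -> U' ⊗ V'}) X :
  {linear U ⊗ (V ⊗ X) -> U' ⊗ (V' ⊗ X)} :=
  tassocr U' V' X \o tmap g idfun \o tassocl U V X.

(* id ⊗ g ⊗ id. *)
Definition tmid U V V' W W' X (g : {linear V ⊗ W -> W' ⊗ V'}) :
  {linear (U ⊗ V) ⊗ (W ⊗ X) -> (U ⊗ W') ⊗ (V' ⊗ X)} :=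
  tassocl U W' (V' ⊗ X) \o tmap idfun (act12 g X) \o tassocr U V (W ⊗ X).

Lemma act12_pure U V U' V' (g : {linear U ⊗ V -> U' ⊗ V'}) X u v x :
  act12 g X (u \tens (v \tens x)) = tassocr _ _ _ (g (u \tens v) \tens x).
Proof.
by rewrite -[LHS]/(tassocr _ _ _ (tmap _ _ (tassocl _ _ _ _))) tassocl_pure tmap_pure.
Qed.

Lemma tmid_pure U V V' W W' X (g : {linear V ⊗ W -> W' ⊗ V'})
    (u : U) (v : V) (w : W) (x : X) :
  tmid U X g (u \tens v \tens (w \tens x)) =
  tassocl _ _ _ (u \tens tassocr _ _ _ (g (v \tens w) \tens x)).
Proof.
rewrite -[LHS]/(tassocl _ _ _ (tmap _ _ (tassocr _ _ _ _))) tassocr_pure.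
by rewrite tmap_pure act12_pure.
Qed.

End TensorMaps.

Notation "f \ot g" := (tmap f g) (at level 40, left associativity) : ring_scope.
Arguments tassocr {K U V W}.
Arguments tassocl {K U V W}.
Arguments tflip {K U V}.
Arguments tlunit {K U}.
Arguments trunit {K U}.
Arguments act12 {K U V U' V'} g {X}.
Arguments tmid {K U V V' W W' X} g.
Arguments tpure_r {K U V} v u.
Arguments tpure_l {K U V} u v.

Section Structures.
Variable K : fieldType.

(* Triple tensor products are bracketed as V ⊗ (V ⊗ V). *)
Definition sigma1 (V : lmodType K) (s : {linear V ⊗ V -> V ⊗ V}) :
  {linear V ⊗ (V ⊗ V) -> V ⊗ (V ⊗ V)} := act12 s.
Definition sigma2 (V : lmodType K) (s : {linear V ⊗ V -> V ⊗ V}) :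
  {linear V ⊗ (V ⊗ V) -> V ⊗ (V ⊗ V)} := idfun \ot s.

Record is_braiding (V : lmodType K) (s : {linear V ⊗ V -> V ⊗ V}) : Prop :=
  IsBraiding {
  braid_bij : bijective s;
  braid_eq : sigma1 s \o sigma2 s \o sigma1 s
             =1 sigma2 s \o sigma1 s \o sigma2 s }.

Record is_algebra (A : lmodType K) (m : {linear A ⊗ A -> A}) (e : A) : Prop :=
  IsAlgebra {
  alg_assoc : m \o (m \ot idfun) =1 m \o (idfun \ot m) \o tassocr;
  alg_unitl : forall a, m (e \tens a) = a;
  alg_unitr : forall a, m (a \tens e) = a }.

Record is_coalgebra (C : lmodType K) (D : {linear C -> C ⊗ C})
  (eps : {linear C -> K^o}) : Prop := IsCoalgebra {
  coalg_coassoc : tassocr \o (D \ot idfun) \o D =1 (idfun \ot D) \o D;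
  coalg_counitl : tlunit \o (eps \ot idfun) \o D =1 idfun;
  coalg_counitr : trunit \o (idfun \ot eps) \o D =1 idfun }.

Record is_YB_algebra (A : lmodType K) (m : {linear A ⊗ A -> A}) (e : A)
  (s : {linear A ⊗ A -> A ⊗ A}) : Prop := IsYBAlgebra {
  yba_alg : is_algebra m e;
  yba_braid : is_braiding s;
  yba_mul_l : (idfun \ot m) \o sigma1 s \o sigma2 s
              =1 s \o (m \ot idfun) \o tassocl;
  yba_mul_r : (m \ot idfun) \o tassocl \o sigma2 s \o sigma1 s
              =1 s \o (idfun \ot m);
  yba_unit_l : forall a, s (e \tens a) = a \tens e;
  yba_unit_r : forall a, s (a \tens e) = e \tens a }.

Record is_YB_coalgebra (C : lmodType K) (D : {linear C -> C ⊗ C})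
  (eps : {linear C -> K^o}) (s : {linear C ⊗ C -> C ⊗ C}) : Prop :=
  IsYBCoalgebra {
  ybc_coalg : is_coalgebra D eps;
  ybc_braid : is_braiding s;
  ybc_comul_l : sigma1 s \o sigma2 s \o tassocr \o (D \ot idfun)
                =1 (idfun \ot D) \o s;
  ybc_comul_r : sigma2 s \o sigma1 s \o (idfun \ot D)
                =1 tassocr \o (D \ot idfun) \o s;
  ybc_counit_l : trunit \o (idfun \ot eps) \o s =1 tlunit \o (eps \ot idfun);
  ybc_counit_r : tlunit \o (eps \ot idfun) \o s =1 trunit \o (idfun \ot eps) }.

Definition tw_coprod (C : lmodType K) (D : {linear C -> C ⊗ C})
  (s : {linear C ⊗ C -> C ⊗ C}) : {linear C ⊗ C -> (C ⊗ C) ⊗ (C ⊗ C)} :=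
  tmid s \o (D \ot D).

Definition tw_counit (C : lmodType K) (eps : {linear C -> K^o}) :
  {linear C ⊗ C -> K^o} := tlunit \o (eps \ot eps).

Definition is_alg_map (A B : lmodType K)
  (mA : {linear A ⊗ A -> A}) (eA : A) (mB : {linear B ⊗ B -> B}) (eB : B)
  (g : {linear A -> B}) : Prop :=
  g \o mA =1 mB \o (g \ot g) /\ g eA = eB.

Definition is_coalg_map (C D : lmodType K)
  (dC : {linear C -> C ⊗ C}) (eC : {linear C -> K^o})
  (dD : {linear D -> D ⊗ D}) (eD : {linear D -> K^o})
  (g : {linear C -> D}) : Prop :=
  dD \o g =1 (g \ot g) \o dC /\ eD \o g =1 eC.

Definition is_grouplike (C : lmodType K) (D : {linear C -> C ⊗ C})
  (eps : {linear C -> K^o}) (e : C) : Prop := D e = e \tens e /\ eps e = 1.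

Definition red_coprod (C : lmodType K) (D : {linear C -> C ⊗ C}) (e x : C) :
  C ⊗ C := D x - x \tens e - e \tens x.

(* F_r C, for the group-like element e. *)
Fixpoint cofilt (C : lmodType K) (D : {linear C -> C ⊗ C}) (e : C) (r : nat)
    (x : C) : Prop :=
  if r is r'.+1 then
    tspan (fun u v => cofilt D e r' u /\ cofilt D e r' v) (red_coprod D e x)
  else exists a : K, x = a *: e.

Definition is_connected (C : lmodType K) (D : {linear C -> C ⊗ C})
  (eps : {linear C -> K^o}) (e : C) : Prop :=
  is_grouplike D eps e /\ forall x, exists r, cofilt D e r x.

Record bialg_data := BialgData {
  bcar :> lmodType K;
  bmul : {linear bcar ⊗ bcar -> bcar};
  bone : bcar;
  bcoprod : {linear bcar -> bcar ⊗ bcar};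
  bcounit : {linear bcar -> K^o};
  bbraid : {linear bcar ⊗ bcar -> bcar ⊗ bcar} }.

(* That the counit sends the unit to 1 is part of is_connected (the unit is
   group-like); it excludes the zero space. *)
Record is_twisted_YB_bialgebra (H : bialg_data) : Prop := IsTwistedYBBialgebra {
  tyb_alg : is_YB_algebra (bmul H) (bone H) (bbraid H);
  tyb_coalg : is_YB_coalgebra (bcoprod H) (bcounit H) (bbraid H);
  tyb_mul : is_coalg_map (tw_coprod (bcoprod H) (bbraid H))
              (tw_counit (bcounit H)) (bcoprod H) (bcounit H) (bmul H);
  tyb_one : bcoprod H (bone H) = bone H \tens bone H }.

Record CB_YB_object (H : bialg_data) : Prop := CBYBObject {
  cb_bialg : is_twisted_YB_bialgebra H;
  cb_conn : is_connected (bcoprod H) (bcounit H) (bone H);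
  cb_conn2 : is_connected (tw_coprod (bcoprod H) (bbraid H))
               (tw_counit (bcounit H)) (bone H \tens bone H) }.

Record CB_YB_morphism (H1 H2 : bialg_data) (g : {linear H1 -> H2}) : Prop :=
  CBYBMorphism {
  cbm_alg : is_alg_map (bmul H1) (bone H1) (bmul H2) (bone H2) g;
  cbm_coalg : is_coalg_map (bcoprod H1) (bcounit H1) (bcoprod H2) (bcounit H2) g;
  cbm_braid : (g \ot g) \o bbraid H1 =1 bbraid H2 \o (g \ot g) }.

End Structures.

Section DirectSum.
Variables (K : fieldType) (E : nat -> lmodType K).

Record dsum := DSum {
  dcomp :> forall n, E n;
  dsum_fin : exists N, forall n, (N <= n)%N -> dcomp n = 0 }.

HB.instance Definition _ := gen_eqMixin dsum.
HB.instance Definition _ := gen_choiceMixin dsum.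

Lemma dsum_ext (x y : dsum) : (forall n, x n = y n) -> x = y.
Proof.
case: x y => [x hx] [y hy] /= h.
have exy := functional_extensionality_dep h; subst y; congr DSum; apply: Prop_irrelevance.
Qed.

Fact dsum_zero_fin : exists N, forall n, (N <= n)%N -> 0 = 0 :> E n.
Proof. by exists 0%N. Qed.
Definition dsum_zero := @DSum (fun n => 0) dsum_zero_fin.

Fact dsum_lin_fin (a : K) (x y : dsum) :
  exists N, forall n, (N <= n)%N -> a *: x n + y n = 0.
Proof.
have [Nx hx] := dsum_fin x; have [Ny hy] := dsum_fin y.
exists (maxn Nx Ny) => n; rewrite geq_max => /andP[hnx hny].
by rewrite hx // hy // scaler0 addr0.
Qed.
Definition dsum_lin a x y := DSum (dsum_lin_fin a x y).
Definition dsum_add x y := dsum_lin 1 x y.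
Definition dsum_scale a x := dsum_lin a x dsum_zero.
Definition dsum_opp x := dsum_scale (-1) x.

Fact dsum_addA : associative dsum_add.
Proof. by move=> x y z; apply: dsum_ext => n /=; rewrite !scale1r addrA. Qed.
Fact dsum_addC : commutative dsum_add.
Proof. by move=> x y; apply: dsum_ext => n /=; rewrite !scale1r addrC. Qed.
Fact dsum_add0 : left_id dsum_zero dsum_add.
Proof. by move=> x; apply: dsum_ext => n /=; rewrite scale1r add0r. Qed.
Fact dsum_addN : left_inverse dsum_zero dsum_opp dsum_add.
Proof.
by move=> x; apply: dsum_ext => n /=; rewrite scale1r addr0 scaleN1r addNr.
Qed.
HB.instance Definition _ :=
  GRing.isZmodule.Build dsum dsum_addA dsum_addC dsum_add0 dsum_addN.

Fact dsum_scaleA a b (x : dsum) :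
  dsum_scale a (dsum_scale b x) = dsum_scale (a * b) x.
Proof. by apply: dsum_ext => n /=; rewrite !addr0 scalerA. Qed.
Fact dsum_scale1 : left_id 1 dsum_scale.
Proof. by move=> x; apply: dsum_ext => n /=; rewrite addr0 scale1r. Qed.
Fact dsum_scaleDr : right_distributive dsum_scale +%R.
Proof.
by move=> a x y; apply: dsum_ext => n /=; rewrite !addr0 !scale1r scalerDr.
Qed.
Fact dsum_scaleDl x : {morph dsum_scale^~ x : a b / a + b}.
Proof.
by move=> a b; apply: dsum_ext => n /=; rewrite !addr0 !scale1r scalerDl.
Qed.
HB.instance Definition _ := GRing.Zmodule_isLmodule.Build K dsum
  dsum_scaleA dsum_scale1 dsum_scaleDr dsum_scaleDl.

Definition dproj n (x : dsum) : E n := x n.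
Fact dproj_is_linear n : linear (dproj n).
Proof. by move=> a x y; rewrite /dproj /= addr0 scale1r. Qed.
HB.instance Definition _ n :=
  GRing.isLinear.Build K dsum (E n) *:%R (dproj n) (dproj_is_linear n).

Definition dinj_comp n (u : E n) m : E m :=
  if @eqP _ n m is ReflectT e then ecast k (E k) e u else 0.

Lemma dinj_comp_same n (u : E n) : dinj_comp u n = u.
Proof. by rewrite /dinj_comp; case: eqP => // e; rewrite (eq_axiomK e). Qed.
Lemma dinj_comp_neq n m (u : E n) : n != m -> dinj_comp u m = 0.
Proof. by rewrite /dinj_comp; case: eqP. Qed.

Fact dinj_fin n (u : E n) :
  exists N, forall m, (N <= m)%N -> dinj_comp u m = 0.
Proof. by exists n.+1 => m h; rewrite dinj_comp_neq // neq_ltn h. Qed.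
Definition dinj n (u : E n) : dsum := DSum (dinj_fin u).

Fact dinj_is_linear n : linear (@dinj n).
Proof.
move=> a u v; apply: dsum_ext => m; rewrite -[RHS]/(dproj m (_ + _)) linearP /dproj /=.
case: (eqVneq n m) => [<-|h]; first by rewrite !dinj_comp_same.
by rewrite !dinj_comp_neq // scaler0 addr0.
Qed.
HB.instance Definition _ n :=
  GRing.isLinear.Build K (E n) dsum *:%R (@dinj n) (@dinj_is_linear n).

Definition dbound (x : dsum) : nat := projT1 (cid (dsum_fin x)).
Lemma dboundP (x : dsum) n : (dbound x <= n)%N -> x n = 0.
Proof. exact: (projT2 (cid (dsum_fin x))). Qed.

Lemma dsum_decomp (x : dsum) N : (forall n, (N <= n)%N -> x n = 0) ->
  x = \sum_(n < N) dinj (x n).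
Proof.
move=> hN; apply: dsum_ext => m; rewrite -[RHS]/(dproj m _) linear_sum /=.
case: (ltnP m N) => hm.
  rewrite (bigD1 (Ordinal hm)) //= big1 ?addr0 ?/dproj /= ?dinj_comp_same //.
  by move=> i; rewrite /dproj /= -val_eqE /= => /dinj_comp_neq.
rewrite hN // big1 // => i _; rewrite /dproj /= dinj_comp_neq //.
by rewrite neq_ltn (leq_trans (ltn_ord i)).
Qed.

Lemma dsum_ind (P : dsum -> Prop) : P 0 -> (forall x y, P x -> P y -> P (x + y)) ->
  (forall n u, P (@dinj n u)) -> forall x, P x.
Proof.
by move=> P0 PD Pi x; rewrite [x](dsum_decomp (@dboundP x)); elim/big_ind: _.
Qed.

Section Lift.
Variables (W : lmodType K) (phi : forall n, E n -> W).

Definition dlift_fun (x : dsum) : W := \sum_(n < dbound x) phi (x n).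

Hypothesis phi_lin : forall n, linear (@phi n).

Lemma dlift_phi0 n : @phi n 0 = 0.
Proof. by have := @phi_lin n (-1) 0 0; rewrite !scaleN1r oppr0 addr0 addNr. Qed.

Lemma dlift_funE (x : dsum) N : (forall n, (N <= n)%N -> x n = 0) ->
  dlift_fun x = \sum_(n < N) phi (x n).
Proof.
have aux M M' : (M <= M')%N -> (forall n, (M <= n)%N -> x n = 0) ->
    \sum_(n < M) phi (x n) = \sum_(n < M') phi (x n).
  move=> hM h; rewrite (big_ord_widen _ (fun n => phi (x n)) hM) /=.
  rewrite [RHS](bigID (fun i : 'I_M' => (i < M)%N)) /= [X in _ = _ + X]big1 ?addr0 //.
  by move=> i; rewrite -leqNgt => /h ->; rewrite dlift_phi0.
move=> hN; rewrite /dlift_fun; case: (leqP (dbound x) N) => h.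
  by apply: aux => // n; apply: dboundP.
by rewrite (aux N (dbound x)) // ltnW.
Qed.

Lemma dlift_fun_linear : linear dlift_fun.
Proof.
move=> a x y; set N := maxn (dbound x) (dbound y).
have hx n : (N <= n)%N -> x n = 0.
  by rewrite geq_max => /andP[h _]; apply: dboundP.
have hy n : (N <= n)%N -> y n = 0.
  by rewrite geq_max => /andP[_ h]; apply: dboundP.
have E1 n : (a *: x + y) n = a *: x n + y n.
  by rewrite -!/(dproj n _) linearP.
rewrite (dlift_funE hx) (dlift_funE hy) (@dlift_funE (a *: x + y) N); last first.
  by move=> n h; rewrite E1 hx // hy // scaler0 addr0.
rewrite scaler_sumr -big_split; apply: eq_bigr => i _.
by rewrite E1 phi_lin.
Qed.

Lemma dlift_fun_inj n (u : E n) : dlift_fun (dinj u) = phi u.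
Proof.
rewrite (@dlift_funE _ n.+1) => [|m h]; last by rewrite /= dinj_comp_neq // neq_ltn h.
rewrite (bigD1 ord_max) //= dinj_comp_same big1 ?addr0 // => i.
by rewrite -val_eqE /= eq_sym => /dinj_comp_neq ->; rewrite dlift_phi0.
Qed.
End Lift.

Definition dlift (W : lmodType K) (phi : forall n, {linear E n -> W}) :
  dsum -> W := dlift_fun phi.
Fact dlift_is_linear (W : lmodType K) (phi : forall n, {linear E n -> W}) : linear (dlift phi).
Proof. by apply: dlift_fun_linear => n; apply: linearP. Qed.
HB.instance Definition _ (W : lmodType K) (phi : forall n, {linear E n -> W}) :=
  GRing.isLinear.Build K dsum W *:%R (dlift phi) (dlift_is_linear phi).

Lemma dlift_inj (W : lmodType K) (phi : forall n, {linear E n -> W}) n (u : E n) :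
  dlift phi (dinj u) = phi n u.
Proof. by apply: (@dlift_fun_inj W phi) => m; apply: linearP. Qed.

End DirectSum.

Arguments dproj {K E} n x.
Arguments dinj {K E} n u.

Section DirectSum2.
Variables (K : fieldType) (E F : nat -> lmodType K) (W : lmodType K).
Variable phi : forall p q, {linear E p ⊗ F q -> W}.

Definition dlift2_fun (x : dsum E) (y : dsum F) : W :=
  dlift_fun (fun p u => dlift_fun (fun q v => phi p q (u \tens v)) y) x.

Fact dlift2_is_bilinear : bilinear_for *:%R *:%R dlift2_fun.
Proof.
have lin_v p u : forall q, linear (fun v => phi p q (u \tens v)).
  by move=> q a v v'; rewrite linearPr linearP.
have lin_u y p :
    linear (fun u => dlift_fun (fun q v => phi p q (u \tens v)) y).
  move=> a u u'; rewrite /dlift_fun scaler_sumr -big_split.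
  by apply: eq_bigr => q _; rewrite linearPl linearP.
split=> [y|x] a z z'; first exact: dlift_fun_linear.
have dE y : dlift2_fun x y = \sum_(p < dbound x)
    dlift_fun (fun q v => phi p q (x p \tens v)) y by [].
rewrite !dE /= scaler_sumr -big_split.
by apply: eq_bigr => p _; apply: dlift_fun_linear.
Qed.
HB.instance Definition _ := bilinear_isBilinear.Build K (dsum E) (dsum F)
  W *:%R *:%R dlift2_fun dlift2_is_bilinear.

(* The linear map on the tensor product of two direct sums given by phi p q
   on E p ⊗ F q, see dlift2_inj. *)
Definition dlift2 : {linear dsum E ⊗ dsum F -> W} := tens_lift dlift2_fun.

Lemma dlift2_inj p q (u : E p) (v : F q) :
  dlift2 (dinj p u \tens dinj q v) = phi p q (u \tens v).
Proof.
rewrite /dlift2 /= tens_liftE /= /dlift2_fun dlift_fun_inj.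
  by rewrite dlift_fun_inj // => n a x y; rewrite linearPr linearP.
move=> n a x y; rewrite /dlift_fun scaler_sumr -big_split.
by apply: eq_bigr => r _; rewrite linearPl linearP.
Qed.
End DirectSum2.

Section ReducedWords.
Local Open Scope nat_scope.

(* The action on nat of the simple transposition exchanging i and i.+1. *)
Definition sswap (i x : nat) : nat :=
  if x == i then i.+1 else if x == i.+1 then i else x.

(* [:: i1; ...; il] expresses w when w = s_i1 \o ... \o s_il, where, indices
   starting from 0, s_i exchanges i and i.+1. *)
Definition is_word n (w : 'S_n) (ws : seq nat) : Prop :=
  all (fun i => i.+1 < n) ws /\ forall x : 'I_n, foldr sswap x ws = w x.

Definition is_reduced n (w : 'S_n) (ws : seq nat) : Prop :=
  is_word w ws /\ forall ws', is_word w ws' -> size ws <= size ws'.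

Definition lehmer n (w : 'S_n) (k : 'I_n) : nat :=
  #|[set l : 'I_n | (k < l) && (w l < w k)]|.

(* The reduced expression (see redword_reduced)
     w = prod_(k = 0, ..., n - 1) s_(k + c_k - 1) ... s_(k + 1) s_k
   given by the Lehmer code c of w. *)
Definition redword n (w : 'S_n) : seq nat :=
  flatten [seq rev (iota k (lehmer w k)) | k : 'I_n <- enum 'I_n].

Definition chi_fun i j (x : 'I_(i + j)) : 'I_(i + j) :=
  cast_ord (addnC j i)
    match split x with inl k => rshift j k | inr k => lshift i k end.

Lemma chi_fun_inj i j : injective (@chi_fun i j).
Proof.
move=> x y /cast_ord_inj h; rewrite -(splitK x) -(splitK y).
move: h; case: (split x) (split y) => k [] l.
- by move=> /rshift_inj ->.
- by move=> /eqP; rewrite eq_rlshift.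
- by move=> /eqP; rewrite eq_lrshift.
- by move=> /lshift_inj ->.
Qed.

(* chi i j sends k to j + k for k < i and i + k to k for k < j. *)
Definition chi i j : 'S_(i + j) := perm (@chi_fun_inj i j).

Lemma chiE i j (x : 'I_(i + j)) :
  chi i j x = (if x < i then j + x else x - i) :> nat.
Proof.
rewrite permE /= /chi_fun /=; case: split_ordP => k -> //=.
by rewrite addKn.
Qed.

Lemma sswap_run k c x : foldr sswap x (rev (iota k c)) =
  if x == k then k + c else if (k < x) && (x <= k + c) then x.-1 else x.
Proof.
elim: c => [|c IH]; first by rewrite /=; do ![case: ifP => ?]; lia.
have -> : rev (iota k c.+1) = (k + c) :: rev (iota k c).
  by rewrite -addn1 iotaD /= rev_cat.
rewrite /= IH; set y := (if x == k then k + c else _).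
have hy : [\/ x = k /\ y = k + c, [/\ k < x, x <= k + c & y = x.-1]
             | (x < k \/ k + c < x) /\ y = x].
  rewrite /y; case: ifP => h1; first by constructor 1; split=> //; lia.
  by case: ifP => h2; [constructor 2; split=> //; lia | constructor 3; split=> //; lia].
move: y hy => y hy; rewrite /sswap.
by do ![case: ifP => ?]; case: hy => [[? ?]|[? ? ?]|[? ?]]; lia.
Qed.

Definition lrank n (w : 'S_n) (k : nat) (x : 'I_n) : nat :=
  #|[set y : 'I_n | (k <= y) && (w y < w x)]|.

Lemma redword_tail n (w : 'S_n) (k : nat) (x : 'I_n) : k <= n ->
  foldr sswap x
    (flatten [seq rev (iota j (lehmer w j)) | j : 'I_n <- drop k (enum 'I_n)])
  = if x < k then x : nat else k + lrank w k x.
Proof.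
move=> hk; rewrite -(subKn hk); move: (n - k) (leq_subr k n) => d hd.
elim: d hd => [|d IH] hd.
  by rewrite subn0 drop_oversize ?size_enum_ord // ltn_ord.
have hlt : n - d.+1 < n by rewrite ltn_subrL; case: (n) hd.
pose k0 := Ordinal hlt.
have ek : n - d = (n - d.+1).+1 by rewrite subnSK.
rewrite (drop_nth k0) ?size_enum_ord // -ek.
have -> : nth k0 (enum 'I_n) (n - d.+1) = k0.
  by apply: val_inj; rewrite /= nth_enum_ord.
rewrite /= foldr_cat IH ?(ltnW hd) // ek.
have := sswap_run k0 (lehmer w k0).
have -> : n - d.+1 = k0 by [].
move: k0 => {hlt ek IH hd d} k0 run; rewrite run.
have rk_x : lrank w k0 x = (w k0 < w x) + lrank w k0.+1 x.
  rewrite /lrank (cardsD1 k0) !inE leqnn /=; congr (_ + _).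
  apply: eq_card => y; rewrite !inE andbA; congr (_ && _).
  by rewrite ltn_neqAle -val_eqE /= eq_sym.
rewrite ltnS leq_eqVlt; have [ex|nx] := eqVneq (x : nat) k0.
  have {ex} -> : x = k0 by apply: val_inj.
  rewrite /= eqxx ltnn; congr (_ + _); rewrite /lehmer /lrank.
  apply: eq_card => y; rewrite !inE (leq_eqVlt k0 y).
  by case: eqP => [/ord_inj <-|] //=; rewrite !ltnn.
case: (ltnP x k0) => hx /=.
  by rewrite (negPf nx) (ltnNge k0 x) (ltnW hx).
have hkx : k0 < x by rewrite ltn_neqAle eq_sym nx hx.
have hxk : (x < k0) = false by lia.
rewrite ?hxk rk_x; case: (ltnP (w k0) (w x)) => hw.
  have hc : lehmer w k0 <= lrank w k0.+1 x.
    apply: subset_leq_card; apply/subsetP => y; rewrite !inE => /andP[-> h] /=.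
    exact: ltn_trans h hw.
  by do ![case: ifP => ?]; lia.
have hw' : w x < w k0.
  rewrite ltn_neqAle hw andbT; apply: contraNneq nx => h.
  by rewrite (perm_inj (val_inj h)).
have hc : lrank w k0.+1 x < lehmer w k0.
  apply: proper_card; apply/properP; split.
    apply/subsetP => y; rewrite !inE => /andP[-> h] /=; exact: ltn_trans h hw'.
  by exists x; rewrite !inE ?hkx ?hw' // ltnn andbF.
by do ![case: ifP => ?]; lia.
Qed.

Lemma card_ord_lt n m : m <= n -> #|[set z : 'I_n | z < m]| = m.
Proof.
move=> hm; transitivity #|[set widen_ord hm j | j : 'I_m]|.
  apply: eq_card => l; rewrite !inE; apply/idP/imsetP => [hl|[j _ ->]].
    by exists (Ordinal hl) => //; apply: val_inj.
  exact: (ltn_ord j).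
by rewrite card_imset ?card_ord // => a b /(congr1 val) /= /val_inj.
Qed.

Lemma redword_word n (w : 'S_n) : is_word w (redword w).
Proof.
split.
  apply/allP => i /flattenP [s /mapP [k _ ->]]; rewrite mem_rev mem_iota.
  move=> /andP [_ hi].
  have h1 : lehmer w k <= #|~: [set l : 'I_n | l < k.+1]|.
    by apply: subset_leq_card; apply/subsetP => l; rewrite !inE ltnS -ltnNge => /andP[].
  have := cardsC [set l : 'I_n | l < k.+1]; rewrite card_ord_lt // card_ord; lia.
move=> x; have := redword_tail w x (leq0n n); rewrite drop0 /redword => ->.
rewrite ltn0 add0n /lrank -[RHS](@card_ord_lt n) ?(ltnW (ltn_ord _)) //.
rewrite -(card_imset _ (@perm_inj _ w)); apply: eq_card => z; rewrite !inE.
apply/imsetP/idP => [[y hy ->]|hz]; first by rewrite inE in hy.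
by exists (w^-1%g z); rewrite ?inE ?permKV.
Qed.

(* The number of inversions of f on the ordinals below n. *)
Definition ninv n (f : 'I_n -> nat) : nat :=
  #|[set p : 'I_n * 'I_n | (p.1 < p.2) && (f p.2 < f p.1)]|.

Lemma ninv_redword n (w : 'S_n) : size (redword w) = ninv (fun x => w x : nat).
Proof.
rewrite /redword size_flatten /shape -map_comp sumnE big_map /=.
rewrite big_enum /= /ninv -sum1_card.
under eq_bigr => k _ do rewrite size_rev size_iota /lehmer -sum1_card.
under eq_bigr => k _ do under eq_bigl => l do rewrite inE.
under [RHS]eq_bigl => l do rewrite inE.
by rewrite pair_big_dep.
Qed.

Lemma ninv_sswap n (f : 'I_n -> nat) i : injective f ->
  ninv (fun x => sswap i (f x)) <= (ninv f).+1.
Proof.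
move=> finj.
pose B := [set p : 'I_n * 'I_n | (f p.1 == i) && (f p.2 == i.+1)].
have hB : #|B| <= 1.
  apply/card_le1P => p; rewrite inE => /andP[/eqP h1 /eqP h2] q.
  rewrite !inE; apply/andP/eqP => [[/eqP h3 /eqP h4]|->]; last by rewrite h1 h2.
  by case: p q h1 h2 h3 h4 => [a b] [c d] /= <- <- /finj -> /finj ->.
apply: (@leq_trans (ninv f + #|B|)); last by rewrite -addn1 leq_add2l.
apply: leq_trans (leq_card_setU _ _); apply: subset_leq_card.
apply/subsetP => -[a b]; rewrite !inE /= => /andP [hab].
have hne : f a <> f b by move/finj => e; rewrite e ltnn in hab.
by rewrite hab /sswap; do ![case: eqP => ?]; lia.
Qed.

Lemma sswap_inj i : injective (sswap i).
Proof. by move=> x y; rewrite /sswap; do ![case: eqP => ?]; lia. Qed.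

Lemma redword_reduced n (w : 'S_n) : is_reduced w (redword w).
Proof.
split; first exact: redword_word.
move=> ws [_ hws]; rewrite ninv_redword.
have -> : ninv (fun x => w x : nat) = ninv (fun x : 'I_n => foldr sswap x ws).
  by apply: eq_card => p; rewrite !inE !hws.
have inj : injective (fun x : 'I_n => foldr sswap x ws).
  by move=> x y; rewrite !hws => /val_inj /perm_inj.
elim: ws {hws} inj => [|i ws IH] inj.
  rewrite /ninv eq_card0 // => p; rewrite !inE /=.
  by case: ltngtP.
apply: leq_trans (ninv_sswap _ _) _; last by rewrite ltnS IH // => x y h; apply: inj; exact: (congr1 (sswap i) h).
by move=> x y h; apply: inj; exact: (congr1 (sswap i) h).
Qed.

End ReducedWords.

Section TensorAlgebra.
Variables (K : fieldType) (V : lmodType K).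

(* V^{⊗n}, as V ⊗ (V ⊗ ... (V ⊗ K)). *)
Fixpoint tpow (n : nat) : lmodType K :=
  if n is n'.+1 then (V ⊗ tpow n' : lmodType K) else (K^o : lmodType K).

Definition tpow1 : {linear tpow 1 -> V} := trunit.

Definition talg := dsum tpow.

Definition tinj (n : nat) : {linear tpow n -> talg} := dinj n.

Definition tone : talg := tinj 0 (1 : K^o).

Fixpoint tcat (i j : nat) : {linear tpow i ⊗ tpow j -> tpow (i + j)} :=
  match i return {linear tpow i ⊗ tpow j -> tpow (i + j)} with
  | 0%N => tlunit
  | i'.+1 => (idfun \ot tcat i' j) \o tassocr
  end.

Definition tcons_fun (v : V) (x : talg) : talg :=
  dlift (fun n => (tinj n.+1 \o tpure_l v : {linear tpow n -> talg})) x.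

Fact tcons_is_bilinear : bilinear_for *:%R *:%R tcons_fun.
Proof.
split=> [x a u v|v a x y]; last by rewrite /tcons_fun linearP.
rewrite /tcons_fun /dlift /dlift_fun /= scaler_sumr -big_split.
by apply: eq_bigr => n _ /=; rewrite /tpure_l linearPl linearP.
Qed.
HB.instance Definition _ := bilinear_isBilinear.Build K V talg talg
  *:%R *:%R tcons_fun tcons_is_bilinear.
Definition tcons : {linear V ⊗ talg -> talg} := tens_lift tcons_fun.

(* v_1 ⊗ ... ⊗ v_n |-> (v_1 ⊗ ... ⊗ v_k) \tens (v_{k+1} ⊗ ... ⊗ v_n), k <= n. *)
Fixpoint tcut (k n : nat) : {linear tpow n -> talg ⊗ talg} :=
  match k, n return {linear tpow n -> talg ⊗ talg} with
  | 0%N, _ => tpure_l tone \o tinj n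
  | k'.+1, n'.+1 => (tcons \ot idfun) \o tassocl \o (idfun \ot tcut k' n')
  | _.+1, 0%N => \0
  end.

Definition tdeconc_comp (n : nat) (x : tpow n) : talg ⊗ talg :=
  \sum_(i < n.+1) tcut i n x.
Fact tdeconc_comp_is_linear n : linear (@tdeconc_comp n).
Proof.
move=> a x y; rewrite /tdeconc_comp scaler_sumr -big_split.
by apply: eq_bigr => i _; rewrite linearP.
Qed.
HB.instance Definition _ n := GRing.isLinear.Build K (tpow n) (talg ⊗ talg)
  *:%R (@tdeconc_comp n) (@tdeconc_comp_is_linear n).

Definition tdeconc : {linear talg -> talg ⊗ talg} := dlift (@tdeconc_comp).

Definition tcounit : {linear talg -> K^o} :=
  (dproj 0%N : {linear talg -> tpow 0}).

Definition Pr_V : {linear talg -> V} := tpow1 \o (dproj 1%N : {linear talg -> tpow 1}).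

Variable s : {linear V ⊗ V -> V ⊗ V}.

(* The braiding s on the factors i and i.+1 (counted from 0) of V^{⊗n}. *)
Fixpoint sigma_at (i n : nat) : {linear tpow n -> tpow n} :=
  match i, n return {linear tpow n -> tpow n} with
  | 0%N, n'.+2 => act12 s
  | i'.+1, n'.+1 => idfun \ot sigma_at i' n'
  | _, _ => idfun
  end.

Fixpoint sigma_word (n : nat) (ws : seq nat) : {linear tpow n -> tpow n} :=
  if ws is i :: ws' then sigma_at i n \o sigma_word n ws' else idfun.

(* T_w is computed from the reduced expression redword w; by the braid
   equation it does not depend on this choice. *)
Definition T_perm (n : nat) (w : 'S_n) : {linear tpow n -> tpow n} :=
  sigma_word n (redword w).

Definition tbraid_comp (i j : nat) :
    {linear tpow i ⊗ tpow j -> talg ⊗ talg} :=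
  if (0 < i)%N && (0 < j)%N
  then (tcut j (i + j) \o T_perm (chi i j) \o tcat i j
          : {linear tpow i ⊗ tpow j -> talg ⊗ talg})
  else (tflip \o (tinj i \ot tinj j)
          : {linear tpow i ⊗ tpow j -> talg ⊗ talg}).

Definition tbraid : {linear talg ⊗ talg -> talg ⊗ talg} := dlift2 tbraid_comp.

Variable m : {linear V ⊗ V -> V}.

Definition M_comp (p q : nat) : {linear tpow p ⊗ tpow q -> V} :=
  match p, q return {linear tpow p ⊗ tpow q -> V} with
  | 1%N, 0%N => tpow1 \o trunit
  | 0%N, 1%N => tpow1 \o tlunit
  | 1%N, 1%N => m \o (tpow1 \ot tpow1)
  | _, _ => \0
  end.

Definition M_map : {linear talg ⊗ talg -> V} := dlift2 M_comp.

End TensorAlgebra.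

Fixpoint tpow_map (K : fieldType) (U V : lmodType K) (g : {linear U -> V})
    (n : nat) : {linear tpow U n -> tpow V n} :=
  match n return {linear tpow U n -> tpow V n} with
  | 0%N => idfun
  | n'.+1 => g \ot tpow_map g n'
  end.

(* X -> X^{⊗(n+1)}, where D is applied at each step to the first factor. *)
Fixpoint iter_coprod (K : fieldType) (X : lmodType K) (D : {linear X -> X ⊗ X})
    (n : nat) : {linear X -> tpow X n.+1} :=
  match n return {linear X -> tpow X n.+1} with
  | 0%N => tpure_r (1 : K^o)
  | n'.+1 => tassocr \o (D \ot idfun) \o iter_coprod D n'
  end.

Section QuasiShuffle.
Variables (K : fieldType) (V : lmodType K).
Variables (m : {linear V ⊗ V -> V}) (s : {linear V ⊗ V -> V ⊗ V}).
Local Notation T := (talg V).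

Definition coprod_beta : {linear T ⊗ T -> (T ⊗ T) ⊗ (T ⊗ T)} :=
  tw_coprod (tdeconc V) (tbraid s).

Definition qsh_comp (n : nat) : {linear T ⊗ T -> tpow V n} :=
  match n return {linear T ⊗ T -> tpow V n} with
  | 0%N => tw_counit (tcounit V)
  | n'.+1 => tpow_map (M_map m) n'.+1 \o iter_coprod coprod_beta n'
  end.

End QuasiShuffle.

Section TspanTheory.
Variables (K : fieldType) (U V : lmodType K).
Implicit Types P : U -> V -> Prop.

Lemma tspan_pure P u v : P u v -> tspan P (u \tens v).
Proof.
by move=> h; rewrite -[_ \tens _]scale1r -[_ *: _]addr0; apply/tspanD/tspan0.
Qed.

Lemma tspan_lin P a x y : tspan P x -> tspan P y -> tspan P (a *: x + y).
Proof.
elim=> [|b u v x' h _ IH] hy; first by rewrite scaler0 add0r.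
by rewrite scalerDr scalerA -addrA; apply: tspanD => //; apply: IH.
Qed.

Lemma tspan_push P (W : lmodType K) (f : {linear U ⊗ V -> W}) (R : W -> Prop) :
  R 0 -> (forall a x y, R x -> R y -> R (a *: x + y)) ->
  (forall u v, P u v -> R (f (u \tens v))) -> forall z, tspan P z -> R (f z).
Proof.
move=> R0 RD h z; elim=> [|a u v x /h huv _ IH]; first by rewrite linear0.
by rewrite linearP; apply: RD.
Qed.

Lemma tspan_full z : tspan (fun (_ : U) (_ : V) => True) z.
Proof.
have [s ->] := tens_sum z; elim: s => [|p s IH].
  by rewrite big_nil; apply: tspan0.
by rewrite big_cons -[_ \tens _]scale1r; apply: tspanD.
Qed.
End TspanTheory.

Section QuasiShuffleFinite.
Variables (K : fieldType) (V : lmodType K).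
Variables (m : {linear V ⊗ V -> V}) (s : {linear V ⊗ V -> V ⊗ V}).
Local Notation T := (talg V).

Let hT (p : nat) (x : T) : Prop := exists a, x = tinj V p a.

(* The elements of total degree d in T ⊗ T. *)
Let homog (d : nat) : T ⊗ T -> Prop :=
  tspan (fun x y => exists p q, [/\ (p + q)%N = d, hT p x & hT q y]).

Let homog2 (d : nat) : (T ⊗ T) ⊗ (T ⊗ T) -> Prop :=
  tspan (fun x y => exists p q, [/\ (p + q)%N = d, homog p x & homog q y]).

Let hcons p v x : hT p x -> hT p.+1 (tcons V (v \tens x)).
Proof.
move=> [a ->]; exists (v \tens a).
by rewrite /tcons /= tens_liftE /= /tcons_fun /tinj /= dlift_inj.
Qed.

Let homog_tcut k n x : homog n (tcut V k n x).
Proof.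
elim: k n x => [|k IH] [|n] x.
- by rewrite /=; apply: tspan_pure; exists 0%N, 0%N; split=> //; [exists (1 : K^o)|exists x].
- by rewrite /=; apply: tspan_pure; exists 0%N, n.+1; split=> //; [exists (1 : K^o)|exists x].
- exact: tspan0.
have hx : tspan (fun (_ : V) (_ : tpow V n) => True) x by apply: tspan_full.
move: x hx; apply: (tspan_push (f := tcut V k.+1 n.+1)) => [||v y _]; [exact: tspan0|exact: tspan_lin|].
rewrite /= tmap_pure /=; move: (IH n y); move: (tcut V k n y) => z.
pose g : {linear T ⊗ T -> T ⊗ T} :=
  (tcons V \ot idfun) \o tassocl \o tpure_l v.
move=> hz; rewrite -[tmap _ _ _]/(g z); move: z hz.
apply: (tspan_push (f := g)) => [||x' y' [p [q [e hx hy]]]]; [exact: tspan0|exact: tspan_lin|].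
rewrite /g /= /tpure_l tassocl_pure tmap_pure; apply: tspan_pure.
by exists p.+1, q; split=> //; [rewrite addSn e | apply: hcons].
Qed.

Let homog_tdeconc p x : hT p x -> homog p (tdeconc V x).
Proof.
move=> [a ->]; rewrite /tdeconc /tinj /= dlift_inj /= /tdeconc_comp.
elim/big_ind: _ => [|y z hy hz|i _]; [exact: tspan0| |exact: homog_tcut].
by rewrite -[y]scale1r; apply: tspan_lin.
Qed.

Let homog_tbraid d z : homog d z -> homog d (tbraid s z).
Proof.
move: z; apply: (tspan_push (f := tbraid s)) => [||x y [p [q [<- [a ->] [b ->]]]]];
  [exact: tspan0|exact: tspan_lin|].
rewrite /tbraid /tinj /= dlift2_inj /tbraid_comp; case: ifP => _ /=.
  exact: homog_tcut.
rewrite tmap_pure tflip_pure; apply: tspan_pure.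
by exists q, p; split; [rewrite addnC | exists b | exists a].
Qed.

Let homog_coprod d z : homog d z -> homog2 d (coprod_beta s z).
Proof.
move: z; apply: (tspan_push (f := coprod_beta s)) => [||x y [p [q [<- hx hy]]]];
  [exact: tspan0|exact: tspan_lin|].
have -> : coprod_beta s (x \tens y)
    = tmid (tbraid s) (tdeconc V x \tens tdeconc V y).
  by rewrite -[LHS]/(tmid _ (tmap _ _ _)) tmap_pure.
move: (homog_tdeconc hx) (homog_tdeconc hy).
move: (tdeconc V x) (tdeconc V y) => z t hz ht.
pose g1 : {linear T ⊗ T -> (T ⊗ T) ⊗ (T ⊗ T)} := tmid (tbraid s) \o tpure_r t.
change (homog2 (p + q) (g1 z)); move: z hz.
apply: (tspan_push (f := g1)) => [||x1 x2 [p1 [p2 [<- hx1 hx2]]]];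
  [exact: tspan0|exact: tspan_lin|].
pose g2 : {linear T ⊗ T -> (T ⊗ T) ⊗ (T ⊗ T)} :=
  tmid (tbraid s) \o tpure_l (x1 \tens x2).
change (homog2 (p1 + p2 + q) (g2 t)); move: t g1 ht => t _; move: t.
apply: (tspan_push (f := g2)) => [||y1 y2 [q1 [q2 [<- hy1 hy2]]]];
  [exact: tspan0|exact: tspan_lin|].
rewrite -[g2 _]/(tmid _ _) tmid_pure.
have : homog (p2 + q1) (tbraid s (x2 \tens y1)).
  by apply: homog_tbraid; apply: tspan_pure; exists p2, q1.
move: (tbraid s (x2 \tens y1)) => w.
pose g3 : {linear T ⊗ T -> (T ⊗ T) ⊗ (T ⊗ T)} :=
  tassocl \o tpure_l x1 \o tassocr \o tpure_r y2.
change (homog (p2 + q1) w -> homog2 (p1 + p2 + (q1 + q2)) (g3 w)); move: w.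
apply: (tspan_push (f := g3)) => [||u v [r1 [r2 [e hu hv]]]];
  [exact: tspan0|exact: tspan_lin|].
rewrite -[g3 _]/(tassocl (x1 \tens tassocr (u \tens v \tens y2))).
rewrite tassocr_pure tassocl_pure; apply: tspan_pure.
exists (p1 + r1)%N, (r2 + q2)%N; split; first by lia.
  by apply: tspan_pure; exists p1, r1.
by apply: tspan_pure; exists r2, q2.
Qed.

Let M_homog0 z : homog 0 z -> M_map m z = 0.
Proof.
move: z; apply: (@tspan_push K T T _ V (M_map m) (fun w => w = 0)) => //.
  by move=> a x y -> ->; rewrite scaler0 addr0.
move=> x y [p [q [+ [a ->] [b ->]]]].
case: p a => // a; case: q b => // b _.
by rewrite /M_map /tinj /= dlift2_inj.
Qed.

Let good (d n : nat) : (T ⊗ T) ⊗ tpow (T ⊗ T) n -> Prop :=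
  tspan (fun x t => tpow_map (M_map m) n t = 0 \/
                    exists2 e, (n + e <= d)%N & homog e x).

Let good_iter d z : homog d z -> forall n, good d (iter_coprod (coprod_beta s) n z).
Proof.
move=> hz; elim=> [|n IH].
  by apply: tspan_pure; right; exists d.
rewrite -[iter_coprod _ _ _]/(tassocr (tmap (coprod_beta s) idfun
  (iter_coprod (coprod_beta s) n z))).
move: (iter_coprod _ n z) IH => w.
pose g : {linear (T ⊗ T) ⊗ tpow (T ⊗ T) n -> (T ⊗ T) ⊗ tpow (T ⊗ T) n.+1} :=
  tassocr \o (coprod_beta s \ot idfun).
change (good d w -> good d (g w)); move: w.
apply: (tspan_push (f := g)) => [||x t ht]; [exact: tspan0|exact: tspan_lin|].
rewrite -[g _]/(tassocr (tmap (coprod_beta s) idfun (x \tens t))) tmap_pure.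
pose h : {linear (T ⊗ T) ⊗ (T ⊗ T) -> (T ⊗ T) ⊗ tpow (T ⊗ T) n.+1} :=
  tassocr \o tpure_r t.
change (good d (h (coprod_beta s x))).
case: ht => [ht|[e hle hx]].
  have hc := tspan_full (coprod_beta s x); move: (coprod_beta s x) hc.
  apply: (tspan_push (f := h)) => [||x1 x2 _]; [exact: tspan0|exact: tspan_lin|].
  rewrite -[h _]/(tassocr (x1 \tens x2 \tens t)) tassocr_pure; apply: tspan_pure; left.
  by rewrite /= tmap_pure ht linear0r.
move: (coprod_beta s x) (homog_coprod hx).
apply: (tspan_push (f := h)) => [||x1 x2 [e1 [e2 [ee h1 h2]]]];
  [exact: tspan0|exact: tspan_lin|].
rewrite -[h _]/(tassocr (x1 \tens x2 \tens t)) tassocr_pure; apply: tspan_pure.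
case: e2 ee h2 => [|e2] ee h2; [left|right].
  by rewrite /= tmap_pure (M_homog0 h2) linear0l.
by exists e1 => //; lia.
Qed.

Let good_zero d n w : (d <= n)%N -> good d w -> tpow_map (M_map m) n.+1 w = 0.
Proof.
move=> hd; move: w; apply: (@tspan_push K _ _ _ (tpow V n.+1)
  (tpow_map (M_map m) n.+1) (fun w => w = 0)) => //.
  by move=> a x y -> ->; rewrite scaler0 addr0.
move=> x t [ht|[e he hx]]; rewrite /= tmap_pure; first by rewrite ht linear0r.
have e0 : e = 0%N by lia.
by rewrite e0 in hx; rewrite (M_homog0 hx) linear0l.
Qed.

Lemma qsh_comp_homog d n (p q : nat) (a : tpow V p) (b : tpow V q) :
  (p + q)%N = d -> (d < n)%N -> qsh_comp m s n (tinj V p a \tens tinj V q b) = 0.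
Proof.
case: n => // n e hn.
rewrite -[LHS]/(tpow_map (M_map m) n.+1 (iter_coprod (coprod_beta s) n _)).
apply: (good_zero (d := d)) => //; apply: good_iter.
by apply: tspan_pure; exists p, q; split=> //; [exists a|exists b].
Qed.

Lemma qsh_comp_fin z :
  exists N, forall n, (N <= n)%N -> qsh_comp m s n z = 0.
Proof.
have lin a x y : (exists N, forall n, (N <= n)%N -> qsh_comp m s n x = 0) ->
    (exists N, forall n, (N <= n)%N -> qsh_comp m s n y = 0) ->
    exists N, forall n, (N <= n)%N -> qsh_comp m s n (a *: x + y) = 0.
  move=> [N1 h1] [N2 h2]; exists (maxn N1 N2) => n.
  rewrite geq_max => /andP[l1 l2].
  by rewrite linearP h1 // h2 // scaler0 addr0.
have zero : exists N, forall n, (N <= n)%N -> qsh_comp m s n 0 = 0.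
  by exists 0%N => n _; rewrite linear0.
have [t ->] := tens_sum z; elim: t => [|[x y] t IH]; first by rewrite big_nil.
rewrite big_cons -[_ \tens _]scale1r; apply: (lin) => // {t IH z} /=.
move: x; apply: dsum_ind => [|x x' hx hx'|p a].
- by rewrite linear0l.
- by rewrite linearDl -[X in X + _]scale1r; apply: (lin).
move: y; apply: dsum_ind => [|y y' hy hy'|q b].
- by rewrite linear0r.
- by rewrite linearDr -[X in X + _]scale1r; apply: (lin).
by exists (p + q).+1 => n hn; apply: (@qsh_comp_homog (p + q)).
Qed.

End QuasiShuffleFinite.

Section CofreeObject.
Variables (K : fieldType) (V : lmodType K).
Variables (m : {linear V ⊗ V -> V}) (s : {linear V ⊗ V -> V ⊗ V}).
Local Notation T := (talg V).

(* The sum of the maps qsh_comp m s n : T ⊗ T -> V^{⊗n}, which is finite on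
   each element by qsh_comp_fin. *)
Definition qsh_fun (z : T ⊗ T) : T :=
  DSum (qsh_comp_fin m s z).
Fact qsh_is_linear : linear qsh_fun.
Proof.
move=> a x y; apply: dsum_ext => n.
by rewrite -[RHS]/(dproj n _) linearP /dproj /= linearP.
Qed.
HB.instance Definition _ := GRing.isLinear.Build K (T ⊗ T) T *:%R qsh_fun
  qsh_is_linear.

Definition qsh : {linear T ⊗ T -> T} := qsh_fun.

Definition Tc : bialg_data K :=
  @BialgData K (talg V) qsh (tone V) (tdeconc V) (tcounit V) (tbraid s).

End CofreeObject.

(* Main.v *)
From HB Require Import structures.
Require Import Defs.
From mathcomp Require Import all_boot all_algebra.
From mathcomp Require Import zify.

(** Put [phi_0 = eps] and [phi_(n+1) = (f ⊗ phi_n) D], that is, [phi_n] is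
    [f^{⊗n}] applied to the iterated coproduct. Since the iterated deconcatenation
    followed by [Pr_V^{⊗n}] is the projection of [T(V)] onto [V^{⊗n}], the only
    coalgebra map extending [f] is the one with components [phi_n];
    connectedness and [f 1 = 0] make it well defined, as [phi_n] vanishes on
    [F_r H] for [r < n].
    It commutes with the braidings because [f] does and because the two
    compatibilities of coproduct and braiding let [alpha] pass through the
    iterated coproducts. It is then compatible with the twisted coproducts on
    [H ⊗ H] and [T(V) ⊗ T(V)], so that multiplicativity, read in [V^{⊗n}],
    reduces to its degree one part [M (fbar ⊗ fbar) = f mul], which is the
    hypothesis on [f] together with [f 1 = 0]. *)

Set Implicit Arguments.
Unset Strict Implicit.
Unset Printing Implicit Defensive.

Import GRing.Theory.
Local Open Scope ring_scope.

(** * Tensor calculus *)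

Section TensorCalculus.
Variable K : fieldType.
Implicit Types U V W X : lmodType K.

Lemma tens_ind U V (P : U ⊗ V -> Prop) :
  P 0 -> (forall x y, P x -> P y -> P (x + y)) ->
  (forall u v, P (u \tens v)) -> forall z, P z.
Proof. by move=> P0 PD Pp z; have [t ->] := tens_sum z; elim/big_ind: _. Qed.

Lemma tpure0l U V (v : V) : (0 : U) \tens v = 0.
Proof. exact: linear0l. Qed.

Lemma tpure0r U V (u : U) : u \tens (0 : V) = 0.
Proof. exact: linear0r. Qed.

Lemma tpureDl U V (u u' : U) (v : V) : (u + u') \tens v = u \tens v + u' \tens v.
Proof. exact: linearDl. Qed.

Lemma tpureDr U V (u : U) (v v' : V) : u \tens (v + v') = u \tens v + u \tens v'.
Proof. exact: linearDr. Qed.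

Lemma tpureZl U V a (u : U) (v : V) : (a *: u) \tens v = a *: (u \tens v).
Proof. exact: linearZl_LR. Qed.

Lemma tpureZr U V a (u : U) (v : V) : u \tens (a *: v) = a *: (u \tens v).
Proof. exact: linearZr_LR. Qed.

Lemma tpure_suml U V I (r : seq I) (P : pred I) (F : I -> U) (v : V) :
  (\sum_(i <- r | P i) F i) \tens v = \sum_(i <- r | P i) F i \tens v.
Proof. exact: (linear_sum (tpure_r v)). Qed.

Lemma tpure_sumr U V I (r : seq I) (P : pred I) (F : I -> V) (u : U) :
  u \tens (\sum_(i <- r | P i) F i) = \sum_(i <- r | P i) u \tens F i.
Proof. exact: (linear_sum (tpure_l u)). Qed.

End TensorCalculus.

(** Zero and sums are settled by linearity, leaving pure tensors. If the other side of the equation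
    is [0], the sum case leaves [0 + 0 = 0] to the caller. *)
Ltac tens_induction z :=
  elim/tens_ind: z;
  [ by rewrite ?(linear0, tpure0l, tpure0r)
  | let x := fresh in let y := fresh in let hx := fresh in let hy := fresh in
    intros x y hx hy;
    rewrite ?(linearD, tpureDl, tpureDr); rewrite hx hy //
  | let u := fresh "u" in let v := fresh "v" in
    intros u v; rewrite ?(tmap_pure, tassocl_pure, tassocr_pure) ].

Section TensorMaps.
Variable K : fieldType.
Implicit Types U V W X : lmodType K.

Lemma tmap_comp U V U1 V1 U2 V2 (f : {linear U1 -> U2}) (g : {linear V1 -> V2})
    (f' : {linear U -> U1}) (g' : {linear V -> V1}) z :
  (f \ot g) ((f' \ot g') z) = ((f \o f') \ot (g \o g')) z.
Proof. by tens_induction z. Qed.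

Lemma eq_tmap U V U1 V1 (f f' : {linear U -> U1}) (g g' : {linear V -> V1}) :
  f =1 f' -> g =1 g' -> f \ot g =1 f' \ot g'.
Proof. by move=> hf hg z; tens_induction z; rewrite hf hg. Qed.

Lemma tmap_id U V (z : U ⊗ V) : (idfun \ot idfun) z = z.
Proof. by tens_induction z. Qed.

Lemma tmap_compr U V U1 V1 V2 (f : {linear U -> U1}) (g : {linear V1 -> V2})
    (h : {linear V -> V1}) z :
  (f \ot (g \o h)) z = (f \ot g) ((idfun \ot h) z).
Proof. by rewrite tmap_comp. Qed.

Lemma tmap_compl U V V1 U1 U2 (f : {linear V -> V1}) (g : {linear U1 -> U2})
    (h : {linear U -> U1}) z :
  ((g \o h) \ot f) z = (g \ot f) ((h \ot idfun) z).
Proof. by rewrite tmap_comp. Qed.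

Lemma tassocrK U V W : cancel (@tassocr K U V W) tassocl.
Proof. by move=> z; tens_induction z; tens_induction u. Qed.

Lemma tassocr_nat U V W U1 V1 W1 (f : {linear U -> U1}) (g : {linear V -> V1})
    (h : {linear W -> W1}) z :
  tassocr (((f \ot g) \ot h) z) = (f \ot (g \ot h)) (tassocr z).
Proof. by tens_induction z; tens_induction u. Qed.

Lemma tassocl_nat U V W U1 V1 W1 (f : {linear U -> U1}) (g : {linear V -> V1})
    (h : {linear W -> W1}) z :
  tassocl ((f \ot (g \ot h)) z) = ((f \ot g) \ot h) (tassocl z).
Proof. by tens_induction z; tens_induction v. Qed.

Lemma tflip_nat U V U1 V1 (f : {linear U -> U1}) (g : {linear V -> V1}) z :
  tflip ((f \ot g) z) = (g \ot f) (tflip z).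
Proof. by tens_induction z; rewrite !tflip_pure tmap_pure. Qed.

Lemma act12E U V U' V' X (g : {linear U ⊗ V -> U' ⊗ V'}) (z : U ⊗ (V ⊗ X)) :
  act12 g z = tassocr ((g \ot idfun) (tassocl z)).
Proof. exact: erefl. Qed.

Lemma tmidE U V V' W W' X (g : {linear V ⊗ W -> W' ⊗ V'})
    (z : (U ⊗ V) ⊗ (W ⊗ X)) :
  tmid g z = tassocl ((idfun \ot act12 g) (tassocr z)).
Proof. exact: erefl. Qed.

Lemma act12_nat U V U' V' X U1 V1 U1' V1' X1
    (f : {linear U -> U1}) (g : {linear V -> V1}) (h : {linear X -> X1})
    (f' : {linear U' -> U1'}) (g' : {linear V' -> V1'})
    (a : {linear U ⊗ V -> U' ⊗ V'}) (b : {linear U1 ⊗ V1 -> U1' ⊗ V1'}) :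
  (forall z, b ((f \ot g) z) = (f' \ot g') (a z)) ->
  forall z, act12 b ((f \ot (g \ot h)) z) = (f' \ot (g' \ot h)) (act12 a z).
Proof.
move=> hab z; rewrite !act12E.
rewrite tassocl_nat tmap_comp -tassocr_nat tmap_comp; congr (tassocr _).
by apply: eq_tmap => // w; apply: hab.
Qed.

(** [g'] and [h'] come out crossed because [a] and [b] exchange the two middle factors. *)
Lemma tmid_nat U V W X V' W' U1 V1 W1 X1 V1' W1'
    (f : {linear U -> U1}) (g : {linear V -> V1}) (h : {linear W -> W1})
    (k : {linear X -> X1}) (g' : {linear V' -> V1'}) (h' : {linear W' -> W1'})
    (a : {linear V ⊗ W -> W' ⊗ V'}) (b : {linear V1 ⊗ W1 -> W1' ⊗ V1'}) :
  (forall z, b ((g \ot h) z) = (h' \ot g') (a z)) -> forall z,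
  tmid b (((f \ot g) \ot (h \ot k)) z) = ((f \ot h') \ot (g' \ot k)) (tmid a z).
Proof.
move=> hab z; rewrite !tmidE.
rewrite tassocr_nat tmap_comp -tassocl_nat tmap_comp; congr (tassocl _).
by apply: eq_tmap => // w; apply: act12_nat.
Qed.

(** Scalars move across the tensor sign. With its mirror image below, this turns counit axioms into
    identities that keep the factor [K^o], the form in which [tpow V 0] occurs. *)
Lemma tlunitK U (z : K^o ⊗ U) : (1 : K^o) \tens tlunit z = z.
Proof.
tens_induction z; rewrite tlunit_pure tpureZr -tpureZl.
by rewrite [X in X \tens _]mulr1.
Qed.

Lemma trunitK U (z : U ⊗ K^o) : trunit z \tens (1 : K^o) = z.
Proof.
tens_induction z; rewrite trunit_pure tpureZl -tpureZr.
by rewrite [X in _ \tens X]mulr1.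
Qed.

End TensorMaps.

(** * Iterated coproducts followed by tensor powers of a map *)

Section Convolution.
Variables (K : fieldType) (V C : lmodType K).
Variables (D : {linear C -> C ⊗ C}) (eps : {linear C -> K^o}).

(** The recursion expands the right factor, as the bracketing of [tpow] does, whereas [iter_coprod]
    splits the first factor; [fpow_iter] reconciles the two. *)
Fixpoint fpow (f : {linear C -> V}) (n : nat) : {linear C -> tpow V n} :=
  match n return {linear C -> tpow V n} with
  | 0%N => eps
  | n'.+1 => (f \ot fpow f n') \o D
  end.

Hypothesis hC : is_coalgebra D eps.
Variable f : {linear C -> V}.
Local Notation F := (fpow f).

Lemma fpowS n x : F n.+1 x = (f \ot F n) (D x).
Proof. by []. Qed.

Lemma fpow1 x : tpow1 V (F 1 x) = f x.
Proof.
have h : f (trunit ((idfun \ot eps) (D x))) = f x.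
  by congr (f _); apply: coalg_counitr hC x.
rewrite -{}h fpowS /tpow1; move: (D x) => z.
by tens_induction z; rewrite !trunit_pure linearZ.
Qed.

Lemma counitl_tens x : (eps \ot idfun) (D x) = (1 : K^o) \tens x.
Proof. by rewrite -[LHS]tlunitK; congr (_ \tens _); apply: coalg_counitl hC x. Qed.

Lemma counitr_tens x : (idfun \ot eps) (D x) = x \tens (1 : K^o).
Proof. by rewrite -[LHS]trunitK; congr (_ \tens _); apply: coalg_counitr hC x. Qed.

Lemma coassoc x : tassocr ((D \ot idfun) (D x)) = (idfun \ot D) (D x).
Proof. exact: (coalg_coassoc hC). Qed.

Lemma coassocl x : (D \ot idfun) (D x) = tassocl ((idfun \ot D) (D x)).
Proof. by rewrite -coassoc tassocrK. Qed.

End Convolution.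

(** * Cutting tensors in two *)

Section Deconcatenation.
Variables (K : fieldType) (V : lmodType K).

Lemma tcons_tinj n v a : tcons V (v \tens tinj V n a) = tinj V n.+1 (v \tens a).
Proof. by rewrite /tcons /= tens_liftE /= /tcons_fun /tinj /= dlift_inj. Qed.

Lemma tcons_tinjE n (z : V ⊗ tpow V n) :
  tcons V ((idfun \ot tinj V n) z) = tinj V n.+1 z.
Proof. by tens_induction z; rewrite tcons_tinj. Qed.

Lemma tcut0 n a : tcut V 0 n a = tone V \tens tinj V n a.
Proof. by case: n a. Qed.

Lemma tcutS i n z : tcut V i.+1 n.+1 z =
  (tcons V \ot idfun) (tassocl ((idfun \ot tcut V i n) z)).
Proof. exact: erefl. Qed.

Variables (C : lmodType K) (D : {linear C -> C ⊗ C}) (eps : {linear C -> K^o}).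
Hypothesis hC : is_coalgebra D eps.
Variable f : {linear C -> V}.
Local Notation F := (fpow D eps f).

(** Induction on the number [i] of letters cut off: the counit axiom gives [i = 0], and
    coassociativity lets one more letter join the left part. *)
Lemma tcut_fpow i n x : (i <= n)%N ->
  tcut V i n (F n x)
  = ((tinj V i \o F i) \ot (tinj V (n - i) \o F (n - i))) (D x).
Proof.
elim: i n x => [|i IH] n x.
  by rewrite subn0 tmap_compl (counitl_tens hC) tmap_pure tcut0.
case: n x => [|n] x // hin; rewrite tcutS fpowS tmap_comp subSS.
transitivity ((tcons V \ot idfun) (tassocl
    ((f \ot ((tinj V i \o F i) \ot (tinj V (n - i) \o F (n - i))))
      ((idfun \ot D) (D x))))).
  rewrite tmap_comp; congr ((tcons V \ot idfun) (tassocl _)).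
  by apply: eq_tmap => // y; rewrite -[RHS]IH.
rewrite tassocl_nat -(coassocl hC) !tmap_comp.
apply: eq_tmap => // y.
by rewrite -[RHS]tcons_tinjE fpowS tmap_comp.
Qed.

End Deconcatenation.

(** * The coalgebra map with prescribed degree one part *)

Section Cofree.
Variables (K : fieldType) (V C : lmodType K).
Variables (D : {linear C -> C ⊗ C}) (eps : {linear C -> K^o}).
Hypothesis hC : is_coalgebra D eps.
Variable f : {linear C -> V}.
Local Notation F := (fpow D eps f).

Lemma fpow_one e n : D e = e \tens e -> f e = 0 -> F n.+1 e = 0.
Proof. by move=> De fe; rewrite fpowS De tmap_pure fe tpure0l. Qed.

(** The parts of [D x] are killed separately: [e ⊗ x] by [f e = 0], [x ⊗ e] because components of
    positive degree vanish on [e], the reduced coproduct by induction on its right factors. *)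
Lemma fpow_cofilt e r x n : D e = e \tens e -> f e = 0 ->
  cofilt D e r x -> (r < n)%N -> F n x = 0.
Proof.
move=> De fe; elim: r x n => [|r IH] x [|n] //.
  by move=> [a ->] _; rewrite linearZ_LR fpow_one // scaler0.
(* Here [r < n] excludes [n = 0], so the right factor of [D x] meets a component of positive
   degree. *)
rewrite ltnS => hx hn; case: n hn => // n hn.
rewrite fpowS.
have Dx : D x = x \tens e + e \tens x + red_coprod D e x.
  by rewrite /red_coprod -[_ - _ - _]addrA -opprD [RHS]addrC subrK.
rewrite -[cofilt _ _ _ _]/(tspan _ (red_coprod D e x)) in hx.
rewrite {}Dx; move: (red_coprod D e x) hx => w hw.
rewrite !linearD !tmap_pure fe tpure0l (fpow_one _ De fe) tpure0r !add0r.
have push := @tspan_push K C C (fun u v => cofilt D e r u /\ cofilt D e r v)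
  _ (f \ot F n.+1) (fun w => w = 0).
apply: push hw => // [a y z -> ->|u v [_ hv]]; first by rewrite scaler0 addr0.
by rewrite tmap_pure (IH v n.+1) // tpure0r.
Qed.

Hypothesis F_fin : forall x, exists N, forall n, (N <= n)%N -> F n x = 0.

Definition cofree_fun (x : C) : talg V := DSum (F_fin x).

Fact cofree_is_linear : linear cofree_fun.
Proof.
move=> a x y; apply: dsum_ext => n.
by rewrite -[RHS]/(dproj n _) linearP /dproj /= linearP.
Qed.
HB.instance Definition _ :=
  GRing.isLinear.Build K C (talg V) *:%R cofree_fun cofree_is_linear.

Definition cofree : {linear C -> talg V} := cofree_fun.

Lemma cofree_sum x N : (forall n, (N <= n)%N -> F n x = 0) ->
  cofree x = \sum_(n < N) tinj V n (F n x).
Proof. by move=> h; rewrite [LHS](@dsum_decomp K (tpow V) (cofree x) N h). Qed.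

(** Every large [N] is allowed so that several truncations can share one [N], as in the sum case
    here. *)
Lemma cofree_tens w : exists N0, forall N, (N0 <= N)%N ->
  (cofree \ot cofree) w = \sum_(p < N) \sum_(q < N)
    ((tinj V p \o F p) \ot (tinj V q \o F q)) w.
Proof.
elim/tens_ind: w => [|x y [Nx hx] [Ny hy]|u v].
- exists 0%N => N _; rewrite linear0 big1 // => p _; rewrite big1 // => q _.
  by rewrite linear0.
- exists (maxn Nx Ny) => N; rewrite geq_max => /andP[lx ly].
  rewrite linearD (hx N) // (hy N) // -big_split; apply: eq_bigr => p _.
  by rewrite -big_split; apply: eq_bigr => q _; rewrite linearD.
have [Nu hu] := F_fin u; have [Nv hv] := F_fin v.
exists (maxn Nu Nv) => N; rewrite geq_max => /andP[lu lv].
rewrite tmap_pure (@cofree_sum u N) => [|n ln]; last exact/hu/(leq_trans lu).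
rewrite (@cofree_sum v N) => [|n ln]; last exact/hv/(leq_trans lv).
rewrite tpure_suml; apply: eq_bigr => p _; rewrite tpure_sumr.
by apply: eq_bigr => q _; rewrite tmap_pure.
Qed.

(** Both sides are double sums of the same terms: by [tcut_fpow] the left one runs over the triangle
    [p + q < N], the right one over the square [p, q < N]. *)
Lemma cofree_coprod x : tdeconc V (cofree x) = (cofree \ot cofree) (D x).
Proof.
have [N0 h0] := cofree_tens (D x); have [N1 h1] := F_fin x.
set N := maxn N0 N1; have hF n : (N <= n)%N -> F n x = 0.
  by rewrite geq_max => /andP[_ /h1].
rewrite (h0 N) ?leq_maxl // (cofree_sum hF) linear_sum.
pose A p q := ((tinj V p \o F p) \ot (tinj V q \o F q)) (D x).
(* Outside the triangle a term is a cut of the component of degree [p + q], which is zero. *)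
have A0 p q : (N <= p + q)%N -> A p q = 0.
  move=> /hF h; have := tcut_fpow hC f x (leq_addr q p).
  by rewrite h linear0 addKn.
transitivity (\sum_(n < N) \sum_(i < n.+1) A i (n - i)%N).
  apply: eq_bigr => n _; rewrite /tdeconc /tinj /= dlift_inj /= /tdeconc_comp.
  by apply: eq_bigr => i _; rewrite tcut_fpow // -ltnS.
transitivity (\sum_(n < N) \sum_(i < N | (i <= n)%N) A i (n - i)%N).
  by apply: eq_bigr => n _; rewrite (big_ord_widen N (fun i => A i (n - i)%N)).
(* With the length [p] of the left part outermost, the inner sums are compared through
   [q = n - p]. *)
rewrite (exchange_big_dep xpredT) //=; apply: eq_bigr => p _.
pose G q := A p q.
transitivity (\sum_(0 <= q < N - p) G q); last first.
  rewrite -(big_mkord xpredT G) [RHS](@big_cat_nat _ _ _ (N - p)%N) ?leq_subr //=.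
  rewrite [X in _ = _ + X]big_nat [X in _ = _ + X]big1 ?addr0 // => q /andP[h _].
  by apply: A0; lia.
transitivity (\sum_(p <= n < N) G (n - p)%N); first by rewrite big_geq_mkord.
by rewrite -{1}[p : nat]add0n big_addn; apply: eq_bigr => q _; rewrite addnK.
Qed.

Lemma Pr_V_cofree x : Pr_V V (cofree x) = f x.
Proof. exact: fpow1. Qed.

Lemma cofree_grouplike e : D e = e \tens e -> eps e = 1 -> f e = 0 ->
  cofree e = tone V.
Proof.
move=> De ee fe; rewrite (@cofree_sum e 1) ?big_ord1 => [|[] // n _].
  by rewrite -[F 0 e]/(eps e) ee.
exact: fpow_one.
Qed.

End Cofree.

(** * The braiding of T(V) *)

Section ChiWord.
Local Open Scope nat_scope.

(** [chi i j] is increasing on the first [i] and on the last [j] positions and sends the former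
    above the latter. *)
Lemma lehmer_chi i j (k : 'I_(i + j)) : lehmer (chi i j) k = if k < i then j else 0.
Proof.
rewrite /lehmer; case: ifP => hk.
  rewrite (_ : [set l | _] = ~: [set l : 'I_(i + j) | l < i]); last first.
    apply/setP => l; rewrite !inE !chiE hk; have := ltn_ord l.
    by case: ifP => hl; lia.
  have := cardsC [set l : 'I_(i + j) | l < i].
  by rewrite card_ord_lt ?leq_addr // card_ord; lia.
apply: eq_card0 => l; rewrite !inE !chiE hk.
by case: ifP => hl; lia.
Qed.

Definition chi_word i j := flatten [seq rev (iota k j) | k <- iota 0 i].

Lemma redword_chi i j : redword (chi i j) = chi_word i j.
Proof.
rewrite /redword.
under eq_map => k do rewrite lehmer_chi.
rewrite (map_comp (fun k => rev (iota k (if k < i then j else 0))) val).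
rewrite val_enum_ord iotaD map_cat flatten_cat add0n.
have -> : [seq rev (iota k (if k < i then j else 0)) | k <- iota i j]
    = [seq [::] | _ <- iota i j].
  by apply/eq_in_map => k; rewrite mem_iota => /andP[h _]; rewrite ltnNge h.
have -> : [seq rev (iota k (if k < i then j else 0)) | k <- iota 0 i]
    = [seq rev (iota k j) | k <- iota 0 i].
  by apply/eq_in_map => k; rewrite mem_iota => /andP[_ ->].
by rewrite (_ : flatten [seq [::] | _ <- _] = [::]) ?cats0 //; elim: (iota _ _).
Qed.

(** The rightmost letters act first: the shifted word carries the last [i] factors across the block
    of [j], then [rev (iota 0 j)] carries the first one. This is the recursion of [braidn]. *)
Lemma chi_wordS i j :
  chi_word i.+1 j = rev (iota 0 j) ++ [seq l.+1 | l <- chi_word i j].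
Proof.
rewrite /chi_word /= map_flatten -map_comp -[1]addn0 iotaDl -map_comp.
congr (_ ++ flatten _); apply: eq_map => k /=.
by rewrite map_rev iotaDl.
Qed.

End ChiWord.

(** * Braiding tensor powers letter by letter *)

Section BraidPowers.
Variables (K : fieldType) (V : lmodType K) (s : {linear V ⊗ V -> V ⊗ V}).

(** One letter crosses [j] letters; in [braidn], [i] letters cross, the last one first. These
    recursive forms can be matched with [fpow] one coproduct at a time. *)
Fixpoint braid1 (j : nat) : {linear V ⊗ tpow V j -> tpow V j ⊗ V} :=
  match j return {linear V ⊗ tpow V j -> tpow V j ⊗ V} with
  | 0%N => tflip
  | j'.+1 => tassocl \o (idfun \ot braid1 j') \o act12 s
  end.

Fixpoint braidn (i j : nat) :
    {linear tpow V i ⊗ tpow V j -> tpow V j ⊗ tpow V i} :=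
  match i return {linear tpow V i ⊗ tpow V j -> tpow V j ⊗ tpow V i} with
  | 0%N => tflip
  | i'.+1 => tassocr \o (braid1 j \ot idfun) \o tassocl
             \o (idfun \ot braidn i' j) \o tassocr
  end.

Lemma braid1S j z :
  braid1 j.+1 z = tassocl ((idfun \ot braid1 j) (act12 s z)).
Proof. exact: erefl. Qed.

Lemma braidnS i j z : braidn i.+1 j z =
  tassocr ((braid1 j \ot idfun) (tassocl ((idfun \ot braidn i j) (tassocr z)))).
Proof. exact: erefl. Qed.

Lemma braidn0 i z : braidn i 0 z = tflip z.
Proof.
elim: i z => [|i IH] z //.
rewrite braidnS (eq_tmap (fun=> erefl) IH).
tens_induction z; tens_induction u.
by rewrite !tflip_pure tassocl_pure tmap_pure tflip_pure tassocr_pure.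
Qed.

Section Intertwine.
Variables (C : lmodType K) (D : {linear C -> C ⊗ C}) (eps : {linear C -> K^o}).
Variables (a : {linear C ⊗ C -> C ⊗ C}) (f : {linear C -> V}).
Hypotheses (hC : is_YB_coalgebra D eps a).
Hypothesis hf : (f \ot f) \o a =1 s \o (f \ot f).
Let hf' z : s ((f \ot f) z) = (f \ot f) (a z). Proof. exact: esym (hf z). Qed.
Local Notation F := (fpow D eps f).

Lemma counit_braid_r z : (eps \ot idfun) (a z) = tflip ((idfun \ot eps) z).
Proof.
rewrite -[LHS]tlunitK -[(idfun \ot eps) z]trunitK tflip_pure.
by congr (_ \tens _); apply: ybc_counit_r hC z.
Qed.

Lemma counit_braid_l z : (idfun \ot eps) (a z) = tflip ((eps \ot idfun) z).
Proof.
rewrite -[LHS]trunitK -[(eps \ot idfun) z]tlunitK tflip_pure.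
by congr (_ \tens _); apply: ybc_counit_l hC z.
Qed.

(** [f] intertwines [a] and [s] at the first crossing, induction treats the others, and
    [ybc_comul_r] merges the two copies of [a] into one. *)
Lemma braid1_fpow j z : braid1 j ((f \ot F j) z) = (F j \ot f) (a z).
Proof.
elim: j z => [|j IH] z.
  rewrite -[braid1 0]/tflip -[F 0]/eps.
  transitivity ((idfun \ot f) ((eps \ot idfun) (a z))); last by rewrite tmap_comp.
  by rewrite counit_braid_r -tflip_nat tmap_comp.
rewrite tmap_compr braid1S (act12_nat _ hf') tmap_comp.
have e w : ((idfun \o f) \ot (braid1 j \o (f \ot F j))) w
    = (f \ot ((F j \ot f) \o a)) w by apply: eq_tmap.
rewrite {}e tmap_compr tassocl_nat.
have -> : (idfun \ot a) (act12 a ((idfun \ot D) z)) = tassocr ((D \ot idfun) (a z)).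
  exact: (ybc_comul_r hC z).
by rewrite tassocrK tmap_comp.
Qed.

(** Induction moves the last [i] letters, [braid1_fpow] the first one, and [ybc_comul_l] merges the
    two braidings. *)
Lemma braidn_fpow i j z : braidn i j ((F i \ot F j) z) = (F j \ot F i) (a z).
Proof.
elim: i z => [|i IH] z.
  rewrite -[braidn 0 j]/tflip -[F 0]/eps.
  transitivity ((F j \ot idfun) ((idfun \ot eps) (a z))); last by rewrite tmap_comp.
  by rewrite counit_braid_l -tflip_nat tmap_comp.
rewrite tmap_compl braidnS tassocr_nat tmap_comp.
have e w : ((idfun \o f) \ot (braidn i j \o (F i \ot F j))) w
    = (f \ot ((F j \ot F i) \o a)) w by apply: eq_tmap.
rewrite {}e tmap_compr tassocl_nat tmap_comp.
have e w : ((braid1 j \o (f \ot F j)) \ot (idfun \o F i)) w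
    = (((F j \ot f) \o a) \ot F i) w by apply: eq_tmap => // u; apply: braid1_fpow.
rewrite {}e tmap_compl tassocr_nat -act12E.
have -> : act12 a ((idfun \ot a) (tassocr ((D \ot idfun) z))) = (idfun \ot D) (a z).
  exact: (ybc_comul_l hC z).
by rewrite tmap_comp.
Qed.

End Intertwine.

(* tcut with its first factor kept in V^{⊗j}, so that braid1 can act on it. *)
Fixpoint tsplit (j n : nat) : {linear tpow V n -> tpow V j ⊗ talg V} :=
  match j, n return {linear tpow V n -> tpow V j ⊗ talg V} with
  | 0%N, _ => tpure_l (1 : K^o) \o tinj V n
  | j'.+1, n'.+1 => tassocl \o (idfun \ot tsplit j' n')
  | _.+1, 0%N => \0
  end.

Lemma tsplit0 n w : tsplit 0 n w = (1 : K^o) \tens tinj V n w.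
Proof. by case: n w. Qed.

Lemma tsplitS j n w : tsplit j.+1 n.+1 w = tassocl ((idfun \ot tsplit j n) w).
Proof. exact: erefl. Qed.

Lemma tcut_tsplit j n w : tcut V j n w = (tinj V j \ot idfun) (tsplit j n w).
Proof.
elim: j n w => [|j IH] n w; first by rewrite tcut0 tsplit0 tmap_pure.
case: n w => [|n] w; first by rewrite linear0.
have e z : (idfun \ot tcut V j n) z
    = (idfun \ot ((tinj V j \ot idfun) \o tsplit j n)) z by apply: eq_tmap.
rewrite tcutS {}e tmap_compr tassocl_nat tmap_comp.
by apply: eq_tmap => // z; rewrite -[RHS]tcons_tinjE.
Qed.

Lemma tinj0 (c : K^o) : tinj V 0 c = (c : K) *: tone V.
Proof. by rewrite /tone -linearZ /= [c in LHS](esym (mulr1 c)). Qed.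

Lemma tsplit_full n w : tsplit n n w = w \tens tone V.
Proof.
elim: n w => [|n IH] w.
  by rewrite tsplit0 tinj0 tpureZr -tpureZl [X in X \tens _]mulr1.
by rewrite tsplitS; tens_induction w; rewrite IH tassocl_pure.
Qed.

Lemma sigma_word_succ n ws z :
  sigma_word s n.+1 [seq l.+1 | l <- ws] z = (idfun \ot sigma_word s n ws) z.
Proof.
elim: ws z => [|i ws IH] z; first by rewrite [RHS]tmap_id.
by rewrite -[LHS]/((idfun \ot sigma_at s i n) _) IH tmap_comp.
Qed.

Lemma sigma_word_cat n ws ws' z :
  sigma_word s n (ws ++ ws') z = sigma_word s n ws (sigma_word s n ws' z).
Proof. by elim: ws => //= i ws ->. Qed.

(** One step of [braid1] is unfolded beside a spectator [X]; the two sides differ only in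
    bracketing. *)
Lemma braid1_assoc j (X : lmodType K) (y : V ⊗ (V ⊗ (tpow V j ⊗ X))) :
  tassocr ((braid1 j.+1 \ot idfun) (tassocl ((idfun \ot tassocl) y))) =
  tassocl ((idfun \ot tassocr) ((idfun \ot (braid1 j \ot idfun))
    ((idfun \ot tassocl) (act12 s y)))).
Proof.
tens_induction y; tens_induction v; tens_induction v0.
rewrite braid1S !act12_pure.
move: (s (u \tens u0)) => t; tens_induction t.
move: (braid1 j _) => r; tens_induction r.
by [].
Qed.

(** After the word [s_(j-1) ... s_0] the first letter stands just behind the next [j], hence at the
    head of the second part of the cut; this explains [tcons]. *)
Lemma tsplit_braid1 j n (z : V ⊗ tpow V n) : (j <= n)%N ->
  tsplit j n.+1 (sigma_word s n.+1 (rev (iota 0 j)) z) =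
  (idfun \ot tcons V) (tassocr ((braid1 j \ot idfun)
    (tassocl ((idfun \ot tsplit j n) z)))).
Proof.
elim: j n z => [|j IH] n z.
  move=> _; rewrite -[sigma_word _ _ _ _]/z tsplit0.
  tens_induction z.
  by rewrite -[braid1 0 _]/(tflip _) tflip_pure tassocr_pure tmap_pure tcons_tinj.
case: n z => // n z hjn.
have -> : rev (iota 0 j.+1) = [seq l.+1 | l <- rev (iota 0 j)] ++ [:: 0%N].
  by rewrite /= rev_cons cats1 map_rev (iotaDl 1 0).
rewrite sigma_word_cat sigma_word_succ.
rewrite -[sigma_word s n.+2 [:: 0%N] z]/(act12 s z) tsplitS tmap_comp.
have e w : ((idfun \o idfun) \ot
      (tsplit j n.+1 \o sigma_word s n.+1 (rev (iota 0 j)))) w =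
    (idfun \ot (idfun \ot tcons V)) ((idfun \ot tassocr)
      ((idfun \ot (braid1 j \ot idfun)) ((idfun \ot tassocl)
        ((idfun \ot (idfun \ot tsplit j n)) w)))).
  by rewrite !tmap_comp; apply: eq_tmap => // u; apply: IH.
have e' : (idfun \ot tsplit j.+1 n.+1) z
    = (idfun \ot tassocl) ((idfun \ot (idfun \ot tsplit j n)) z).
  exact: tmap_compr.
(* [tsplit j n] acts beyond the first two factors, so [act12 s] commutes with it by naturality in
   the spectator alone. *)
have hs u : s ((idfun \ot idfun) u) = (idfun \ot idfun) (s u).
  by rewrite !tmap_id.
rewrite {}e {}e' -(act12_nat _ hs) tassocl_nat -braid1_assoc.
by apply: eq_tmap => // u; rewrite tmap_id.
Qed.

(** The word and [braidn] share one recursion: the shifted part is the induction hypothesis, the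
    first run is [tsplit_braid1]. *)
Lemma tsplit_chi i j z :
  tsplit j (i + j) (sigma_word s (i + j) (chi_word i j) (tcat V i j z))
  = (idfun \ot tinj V i) (braidn i j z).
Proof.
elim: i z => [|i IH] z.
  rewrite -[sigma_word _ _ _ _]/(tlunit z) -[braidn 0 j]/tflip.
  tens_induction z.
  rewrite tlunit_pure -[LHS]/(tsplit j j (u *: v)) linearZ_LR tsplit_full.
  by rewrite tflip_pure tmap_pure tinj0 tpureZr.
rewrite chi_wordS sigma_word_cat -[tcat V i.+1 j z]/((idfun \ot tcat V i j) (tassocr z)).
rewrite sigma_word_succ tsplit_braid1 ?leq_addl // !tmap_comp braidnS.
have e w : ((idfun \o (idfun \o idfun)) \ot (tsplit j (i + j)
    \o (sigma_word s (i + j) (chi_word i j) \o tcat V i j))) w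
  = (idfun \ot ((idfun \ot tinj V i) \o braidn i j)) w by apply: eq_tmap.
rewrite {}e tmap_compr tassocl_nat.
move: (tassocl _) => w.
have -> : (braid1 j \ot idfun) (((idfun \ot idfun) \ot tinj V i) w)
    = ((idfun \ot idfun) \ot tinj V i) ((braid1 j \ot idfun) w).
  by rewrite !tmap_comp; apply: eq_tmap => // u; rewrite /= !tmap_id.
rewrite tassocr_nat tmap_comp.
by apply: eq_tmap => // u; rewrite -[RHS]tcons_tinjE.
Qed.

Lemma tbraid_compE i j z : tbraid_comp s i j z = (tinj V j \ot tinj V i) (braidn i j z).
Proof.
rewrite /tbraid_comp; case: ifP => h; last first.
  rewrite -[LHS]/(tflip _) tflip_nat; congr (tmap _ _ _).
  (* When a degree is zero, [braidn] is the flip: by definition for [i = 0], by [braidn0] for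
     [j = 0]. *)
  case: i j z h => [|i] [|j] z // _.
  by rewrite braidn0.
rewrite -[LHS]/(tcut V j (i + j) (T_perm s (chi i j) (tcat V i j z))).
by rewrite tcut_tsplit /T_perm redword_chi tsplit_chi tmap_comp.
Qed.

End BraidPowers.

Section DirectSumTensor.
Variables (K : fieldType) (E F : nat -> lmodType K) (W : lmodType K).

Lemma dsum_tens_ext (f g : {linear dsum E ⊗ dsum F -> W}) :
  (forall p q u v, f (dinj p u \tens dinj q v) = g (dinj p u \tens dinj q v)) ->
  f =1 g.
Proof.
move=> h; apply: tens_ext => x y.
elim/dsum_ind: x => [|x x' hx hx'|p u]; first by rewrite tpure0l !linear0.
  by rewrite tpureDl !linearD hx hx'.
elim/dsum_ind: y => [|y y' hy hy'|q v]; first by rewrite tpure0r !linear0.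
  by rewrite tpureDr !linearD hy hy'.
exact: h.
Qed.

Lemma dlift2_tmap (phi : forall p q, {linear E p ⊗ F q -> W}) p q w :
  dlift2 phi ((dinj p \ot dinj q) w) = phi p q w.
Proof.
apply: (tens_ext (f := dlift2 phi \o (dinj p \ot dinj q)) (g := phi p q)) => u v.
by rewrite -[LHS]/(dlift2 phi ((dinj p \ot dinj q) (u \tens v))) tmap_pure dlift2_inj.
Qed.

Lemma dproj_dinj n (u : E n) : dproj n (dinj n u) = u.
Proof. exact: dinj_comp_same. Qed.

Lemma dproj_dinj_neq n m (u : E n) : n != m -> dproj m (dinj n u) = 0.
Proof. exact: dinj_comp_neq. Qed.

Lemma dsum_lin_ext (f g : {linear dsum E -> W}) :
  (forall n u, f (dinj n u) = g (dinj n u)) -> f =1 g.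
Proof.
move=> h; elim/dsum_ind => [|x y hx hy|n u]; first by rewrite !linear0.
  by rewrite !linearD hx hy.
exact: h.
Qed.

End DirectSumTensor.

Section CofreeBraid.
Variables (K : fieldType) (V C : lmodType K) (s : {linear V ⊗ V -> V ⊗ V}).
Variables (D : {linear C -> C ⊗ C}) (eps : {linear C -> K^o}).
Variables (a : {linear C ⊗ C -> C ⊗ C}) (f : {linear C -> V}).
Hypotheses (hC : is_YB_coalgebra D eps a).
Hypothesis hf : (f \ot f) \o a =1 s \o (f \ot f).
Local Notation F := (fpow D eps f).
Hypothesis F_fin : forall x, exists N, forall n, (N <= n)%N -> F n x = 0.
Local Notation Phi := (cofree F_fin).

Lemma cofree_braid z : tbraid s ((Phi \ot Phi) z) = (Phi \ot Phi) (a z).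
Proof.
have [N1 h1] := cofree_tens F_fin z; have [N2 h2] := cofree_tens F_fin (a z).
rewrite (h1 (maxn N1 N2)) ?leq_maxl // (h2 (maxn N1 N2)) ?leq_maxr //.
(* The braiding sends bidegree [(p, q)] to [(q, p)], so one double sum is transposed before
   comparing terms. *)
rewrite linear_sum [RHS]exchange_big; apply: eq_bigr => p _.
rewrite linear_sum; apply: eq_bigr => q _ /=.
rewrite -!tmap_comp -(braidn_fpow hC hf) -tbraid_compE.
exact: dlift2_tmap.
Qed.

End CofreeBraid.

(** * Uniqueness and multiplicativity *)

Section TensorAlgebraMaps.
Variables (K : fieldType) (V : lmodType K).
Local Notation T := (talg V).

Lemma tcounit_tinj0 (u : tpow V 0) : tcounit V (tinj V 0 u) = u.
Proof. exact: dproj_dinj. Qed.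

Lemma tcounit_tinjS n (u : tpow V n.+1) : tcounit V (tinj V n.+1 u) = 0.
Proof. exact: dproj_dinj_neq. Qed.

Lemma Pr_V_tinj1 (u : tpow V 1) : Pr_V V (tinj V 1 u) = tpow1 V u.
Proof. by rewrite -[LHS]/(tpow1 V (dproj 1 (dinj 1 u))) dproj_dinj. Qed.

Lemma Pr_V_tinj_neq n (u : tpow V n) : n != 1%N -> Pr_V V (tinj V n u) = 0.
Proof.
by move=> h; rewrite -[LHS]/(tpow1 V (dproj 1 (dinj n u))) dproj_dinj_neq ?linear0.
Qed.

Lemma dproj_tcons n z : dproj n.+1 (tcons V z) = (idfun \ot dproj n) z.
Proof.
apply: (tens_ext (f := dproj n.+1 \o tcons V) (g := idfun \ot dproj n)) => v x.
rewrite tmap_pure; apply: (dsum_lin_ext (f := dproj n.+1 \o tcons V \o tpure_l v)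
  (g := tpure_l v \o dproj n)) => k a.
rewrite -[LHS]/(dproj n.+1 (tcons V (v \tens tinj V k a))) tcons_tinj.
rewrite -[RHS]/(v \tens dproj n (dinj k a)) -[tinj V _ _]/(dinj k.+1 _).
have [<-|h] := eqVneq k n; first by rewrite !dproj_dinj.
by rewrite !dproj_dinj_neq // tpure0r.
Qed.

Lemma tcounit_tcons z : tcounit V (tcons V z) = 0.
Proof.
apply: (tens_ext (f := tcounit V \o tcons V) (g := \0)) => v x.
apply: (dsum_lin_ext (f := tcounit V \o tcons V \o tpure_l v) (g := \0)) => k a.
rewrite -[LHS]/(tcounit V (tcons V (v \tens tinj V k a))) tcons_tinj.
exact: tcounit_tinjS.
Qed.

Lemma Pr_V_tcons v x : Pr_V V (tcons V (v \tens x)) = (tcounit V x : K) *: v.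
Proof.
rewrite -[LHS]/(tpow1 V (dproj 1 (tcons V (v \tens x)))) dproj_tcons tmap_pure.
exact: trunit_pure.
Qed.

(** The summands are the components of bidegrees [(0, 1)], [(1, 0)] and [(1, 1)]. The formula is
    bilinear, so homogeneous elements suffice. *)
Lemma M_mapE (m : {linear V ⊗ V -> V}) (x y : T) : M_map m (x \tens y) =
  (tcounit V x : K) *: Pr_V V y + (tcounit V y : K) *: Pr_V V x
  + m (Pr_V V x \tens Pr_V V y).
Proof.
pose G : {linear T ⊗ T -> V} := (tlunit \o (tcounit V \ot Pr_V V))
  \+ (trunit \o (Pr_V V \ot tcounit V)) \+ (m \o (Pr_V V \ot Pr_V V)).
have GE x' y' : G (x' \tens y') = (tcounit V x' : K) *: Pr_V V y'
    + (tcounit V y' : K) *: Pr_V V x' + m (Pr_V V x' \tens Pr_V V y').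
  rewrite -[LHS]/(tlunit ((tcounit V \ot Pr_V V) (x' \tens y'))
    + trunit ((Pr_V V \ot tcounit V) (x' \tens y'))
    + m ((Pr_V V \ot Pr_V V) (x' \tens y'))).
  by rewrite !tmap_pure tlunit_pure trunit_pure.
rewrite -GE; move: (x \tens y); apply: dsum_tens_ext => p q u v.
rewrite GE -![dinj _ _]/(tinj V _ _) {1}/M_map dlift2_inj.
case: p u => [|[|p]] u; case: q v => [|[|q]] v;
  rewrite ?(tcounit_tinj0, tcounit_tinjS, Pr_V_tinj1, Pr_V_tinj_neq) //;
  rewrite ?(scaler0, scale0r, tpure0l, tpure0r, linear0, addr0, add0r) //.
- by rewrite -[LHS]/(tpow1 V (tlunit (u \tens v))) tlunit_pure linearZ_LR.
- by rewrite -[LHS]/(tpow1 V (trunit (u \tens v))) trunit_pure linearZ_LR.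
by rewrite -[LHS]/(m ((tpow1 V \ot tpow1 V) (u \tens v))) tmap_pure.
Qed.

Lemma tcounit_tcut i n a : (tcounit V \ot idfun) (tcut V i.+1 n a) = 0.
Proof.
case: n a => [|n] a; first by rewrite linear0.
rewrite tcutS; move: (tassocl _) => z; tens_induction z; first by rewrite addr0.
by rewrite tcounit_tcons tpure0l.
Qed.

(** [Pr_V] sees the left part only if nothing follows its first letter, which [tcounit] tests. *)
Lemma Pr_V_tcut i n (z : V ⊗ tpow V n) :
  (Pr_V V \ot idfun) (tcut V i.+1 n.+1 z)
  = (idfun \ot tlunit) ((idfun \ot (tcounit V \ot idfun))
      ((idfun \ot tcut V i n) z)).
Proof.
rewrite tcutS; tens_induction z.
move: (tcut V i n v) => z; tens_induction z.
by rewrite Pr_V_tcons tlunit_pure tpureZl tpureZr.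
Qed.

Lemma Pr_V_sum_tcut n (z : V ⊗ tpow V n) :
  (Pr_V V \ot idfun) (\sum_(i < n.+1) tcut V i.+1 n.+1 z)
  = (idfun \ot tinj V n) z.
Proof.
(* Cuts after two or more letters are invisible to [Pr_V]. *)
have h i : (Pr_V V \ot idfun) (tcut V i.+2 n.+1 z) = 0.
  rewrite Pr_V_tcut; tens_induction z; first by rewrite addr0.
  by rewrite tcounit_tcut linear0 tpure0r.
rewrite linear_sum big_ord_recl big1 => [|i _]; last exact: h.
rewrite addr0 -[LHS]/((Pr_V V \ot idfun) (tcut V 1 n.+1 z)) Pr_V_tcut !tmap_comp.
apply: eq_tmap => // a.
rewrite -[LHS]/(tlunit ((tcounit V \ot idfun) (tcut V 0 n a))).
by rewrite tcut0 tmap_pure tlunit_pure tcounit_tinj0 scale1r.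
Qed.

(** Only the cut after one letter contributes. This is the recursion of [fpow], whence a coalgebra
    map into [T(V)] is determined by its degree one part. *)
Lemma dproj_deconc n x :
  dproj n.+1 x = (Pr_V V \ot dproj n) (tdeconc V x).
Proof.
transitivity ((idfun \ot dproj n) ((Pr_V V \ot idfun) (tdeconc V x))); last first.
  by rewrite tmap_comp.
apply: (dsum_lin_ext (f := dproj n.+1)
  (g := (idfun \ot dproj n) \o (Pr_V V \ot idfun) \o tdeconc V)) => k a.
rewrite -[RHS]/((idfun \ot dproj n) ((Pr_V V \ot idfun) (tdeconc V (dinj k a)))).
have -> : tdeconc V (dinj k a) = \sum_(i < k.+1) tcut V i k a.
  by rewrite /tdeconc /= dlift_inj.
(* The empty cut drops out, its left part [tone] having degree zero. *)
rewrite big_ord_recl tcut0 linearD tmap_pure Pr_V_tinj_neq // tpure0l add0r.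
case: k a => [|k] a.
  by rewrite big_ord0 !linear0 -[LHS]/(dproj n.+1 (dinj 0 a)) dproj_dinj_neq.
rewrite Pr_V_sum_tcut -dproj_tcons tcons_tinjE //.
Qed.

Lemma fpow_unique (C : lmodType K) (D : {linear C -> C ⊗ C}) (eps : {linear C -> K^o})
    (g : {linear C -> T}) (f : {linear C -> V}) :
  is_coalg_map D eps (tdeconc V) (tcounit V) g -> Pr_V V \o g =1 f ->
  forall n x, dproj n (g x) = fpow D eps f n x.
Proof.
move=> [gD ge] gf; elim=> [|n IH] x; first exact: ge.
have -> : dproj n.+1 (g x) = (Pr_V V \ot dproj n) (tdeconc V (g x)).
  exact: dproj_deconc.
rewrite -[tdeconc V (g x)]/((tdeconc V \o g) x) gD fpowS tmap_comp.
exact: eq_tmap.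
Qed.

End TensorAlgebraMaps.

(** * Naturality of iterated coproducts *)

Section IterCoprod.
Variable K : fieldType.
Implicit Types X Y Z : lmodType K.

Lemma tpow_map_comp X Y Z (g : {linear Y -> Z}) (h : {linear X -> Y}) n z :
  tpow_map g n (tpow_map h n z) = tpow_map (g \o h) n z.
Proof.
elim: n z => [|n IH] z //.
rewrite -[LHS]/((g \ot tpow_map g n) ((h \ot tpow_map h n) z)) tmap_comp.
exact: eq_tmap.
Qed.

Lemma eq_tpow_map X Y (g h : {linear X -> Y}) n :
  g =1 h -> tpow_map g n =1 tpow_map h n.
Proof. by move=> e; elim: n => [|n IH] z //; apply: eq_tmap. Qed.

(** Serves both for the multiplication of [H] and for [Phi ⊗ Phi]. *)
Lemma iter_coprod_nat X Y (DX : {linear X -> X ⊗ X}) (DY : {linear Y -> Y ⊗ Y})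
    (g : {linear X -> Y}) n x :
  (forall x, DY (g x) = (g \ot g) (DX x)) ->
  iter_coprod DY n (g x) = tpow_map g n.+1 (iter_coprod DX n x).
Proof.
move=> hg; elim: n x => [|n IH] x; first by rewrite [RHS]tmap_pure.
rewrite -[LHS]/(tassocr ((DY \ot idfun) (iter_coprod DY n (g x)))) IH.
rewrite -[RHS]/((g \ot (g \ot tpow_map g n))
  (tassocr ((DX \ot idfun) (iter_coprod DX n x)))).
rewrite -tassocr_nat; congr (tassocr _).
rewrite -[tpow_map g n.+1 _]/((g \ot tpow_map g n) _) !tmap_comp.
exact: eq_tmap.
Qed.

Lemma fpow_tpow_map X Y (D : {linear X -> X ⊗ X}) (eps : {linear X -> K^o})
    (f : {linear X -> Y}) n x :
  fpow D eps f n x = tpow_map f n (fpow D eps idfun n x).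
Proof.
elim: n x => [|n IH] x //.
rewrite -[RHS]/((f \ot tpow_map f n) ((idfun \ot fpow D eps idfun n) (D x))).
by rewrite tmap_comp; apply: eq_tmap.
Qed.

(** Coassociativity turns splitting on the right into splitting on the left; the counit ending
    [fpow] absorbs its one extra coproduct. *)
Lemma fpow_iter X Y (D : {linear X -> X ⊗ X}) (eps : {linear X -> K^o})
    (f : {linear X -> Y}) n x : is_coalgebra D eps ->
  fpow D eps f n.+1 x = tpow_map f n.+1 (iter_coprod D n x).
Proof.
move=> hX; rewrite fpow_tpow_map; congr (tpow_map f n.+1 _).
elim: n x => [|n IH] x; first by rewrite fpowS -[fpow _ _ _ 0]/eps (counitr_tens hX).
rewrite -[RHS]/(tassocr ((D \ot idfun) (iter_coprod D n x))) -IH !fpowS.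
transitivity ((idfun \ot (idfun \ot fpow D eps idfun n)) ((idfun \ot D) (D x))).
  exact: tmap_compr.
rewrite -(coassoc hX) -tassocr_nat !tmap_comp; congr (tassocr _).
by apply: eq_tmap => // u; rewrite /= tmap_id.
Qed.

End IterCoprod.

Theorem proposition12 (K : fieldType) (charK : [pchar K] =i pred0)
  (V : lmodType K) (m : {linear V ⊗ V -> V}) (e : V)
  (s : {linear V ⊗ V -> V ⊗ V}) (hV : is_YB_algebra m e s)
  (H : bialg_data K) (hH : CB_YB_object H)
  (f : {linear H -> V})
  (f_mul : forall z : H ⊗ H,
     tspan (fun x y => bcounit H x = 0 /\ bcounit H y = 0) z ->
     m ((f \ot f) z) = f (bmul H z))
  (f_one : f (bone H) = 0)
  (f_braid : (f \ot f) \o bbraid H =1 s \o (f \ot f)) :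
  exists fbar : {linear H -> Tc m s},
    (CB_YB_morphism fbar /\ Pr_V V \o fbar =1 f) /\
    (forall g : {linear H -> Tc m s},
       CB_YB_morphism g -> Pr_V V \o g =1 f -> g =1 fbar).
Proof.
case: hH => -[Halg Hcoalg [H_mulD H_mul_eps] _] [[De ee] H_conn] _.
have hC := ybc_coalg Hcoalg.
have F_fin x : exists N, forall n, (N <= n)%N ->
    fpow (bcoprod H) (bcounit H) f n x = 0.
  have [r hr] := H_conn x; exists r.+1 => n hn.
  exact: fpow_cofilt De f_one hr hn.
pose Phi : {linear H -> talg V} := cofree F_fin.
have PhiD x : tdeconc V (Phi x) = (Phi \ot Phi) (bcoprod H x).
  exact: cofree_coprod.
have PhiB z : tbraid s ((Phi \ot Phi) z) = (Phi \ot Phi) (bbraid H z).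
  exact: cofree_braid.
have PhiF x : Pr_V V (Phi x) = f x by exact: Pr_V_cofree.
(* The hypothesis on [f] concerns the kernel of the counit only, so each factor is split as
   [u' + eps(u) 1]. *)
have M_Phi z : M_map m ((Phi \ot Phi) z) = f (bmul H z).
  apply: (tens_ext (f := M_map m \o (Phi \ot Phi)) (g := f \o bmul H)) => x y.
  rewrite -[LHS]/(M_map m ((Phi \ot Phi) (x \tens y))) tmap_pure M_mapE !PhiF.
  rewrite -![tcounit V (Phi _)]/(bcounit H _) -[RHS]/(f (bmul H (x \tens y))).
  have dec u : exists2 u', bcounit H u' = 0 & u = u' + (bcounit H u : K) *: bone H.
    exists (u - (bcounit H u : K) *: bone H); last by rewrite subrK.
    by rewrite linearB linearZ /= ee [X in _ - X]mulr1 subrr.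
  have f_dec u a : f (u + a *: bone H) = f u.
    by rewrite linearD linearZ_LR f_one scaler0 addr0.
  have [x' x'0 ->] := dec x; have [y' y'0 ->] := dec y.
  move: (bcounit H x) (bcounit H y) => a b.
  have eps_dec u c : bcounit H u = 0 -> bcounit H (u + (c : K) *: bone H) = c.
    by move=> u0; rewrite linearD linearZ /= u0 ee add0r [LHS]mulr1.
  have [_ mul1 mul1'] := yba_alg Halg.
  (* Besides [x' y'] only multiples of [x'] and of the second factor remain; [f] sends them to the
     terms of [M] in bidegrees [(1, 0)] and [(0, 1)]. *)
  have -> : bmul H ((x' + (a : K) *: bone H) \tens (y' + (b : K) *: bone H))
      = bmul H (x' \tens y') + (b : K) *: x' + (a : K) *: (y' + (b : K) *: bone H).
    set y1 := (y' + _).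
    rewrite tpureDl linearD tpureZl linearZ_LR mul1 {1}/y1.
    by rewrite tpureDr linearD tpureZr linearZ_LR mul1'.
  rewrite !eps_dec // !f_dec linearD linearD !linearZ_LR f_dec.
  have := f_mul _ (tspan_pure (conj x'0 y'0)); rewrite tmap_pure => <-.
  by rewrite -[RHS]addrA [RHS]addrC [X in _ = X + _]addrC.
have PhiM z : Phi (bmul H z) = qsh m s ((Phi \ot Phi) z).
  apply: dsum_ext => -[|n].
    (* Degree zero is multiplicativity of the counit. *)
    rewrite -[LHS]/((bcounit H \o bmul H) z) H_mul_eps.
    rewrite -[LHS]/(tlunit ((bcounit H \ot bcounit H) z)).
    rewrite -[RHS]/(tlunit ((tcounit V \ot tcounit V) ((Phi \ot Phi) z))) tmap_comp.
    by congr (tlunit _); apply: eq_tmap.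
  (* In positive degree the iterated coproduct is carried through the product of [H] and through
     [Phi ⊗ Phi], leaving [M_Phi] in every factor. *)
  rewrite -[LHS]/(fpow (bcoprod H) (bcounit H) f n.+1 (bmul H z)) (fpow_iter _ _ _ hC).
  rewrite (iter_coprod_nat _ _ H_mulD).
  rewrite -[RHS]/(tpow_map (M_map m) n.+1 (iter_coprod (coprod_beta s) n ((Phi \ot Phi) z))).
  rewrite (@iter_coprod_nat _ _ _ (tw_coprod (bcoprod H) (bbraid H))) => [|w].
    by rewrite !tpow_map_comp; apply: eq_tpow_map => w; rewrite /= M_Phi.
  (* [Phi ⊗ Phi] respects the twisted coproducts: [PhiD] treats the two coproducts, [PhiB] the
     braiding between them. *)
  rewrite -[LHS]/(tmid (tbraid s) ((tdeconc V \ot tdeconc V) ((Phi \ot Phi) w))).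
  rewrite tmap_comp.
  transitivity (tmid (tbraid s) (((Phi \ot Phi) \ot (Phi \ot Phi))
    ((bcoprod H \ot bcoprod H) w))); last exact: tmid_nat.
  by rewrite tmap_comp; congr (tmid _ _); apply: eq_tmap.
exists Phi; split; first split=> //.
  split; first split=> //.
  - exact: cofree_grouplike.
  - by split.
  - by move=> z; exact: esym (PhiB z).
move=> g [_ g_coalg _] gf x; apply: dsum_ext => n.
by rewrite -[LHS]/(dproj n (g x)) (fpow_unique g_coalg gf).
Qed.
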